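(* For any $K$-linear semigroupal 2-category $(\mathcal C,\otimes,a,\pi)$, the $\omega$-equivalence classes of its first order pentagonator-deformations are in bijection with the elements of $H^3_{pent}(\mathcal C)$.
   Context: Conventions. $K$ is a commutative ring with unit. 2-categories are strict; $id_X$, $1_f$ are identity 1- and 2-morphisms, $\sigma\cdot\tau$ is vertical composition (first $\tau$), $\circ$ is composition of 1-morphisms ($g\circ f$: first $f$) and horizontal composition of 2-morphisms. A 2-category is $K$-linear if sets of 2-morphisms are $K$-modules and vertical and horizontal composition are $K$-bilinear. A pseudonatural transformation $\xi:\mathcal F\Rightarrow\mathcal G$ has 1-morphisms $\xi_X:\mathcal F(X)\to\mathcal G(X)$ and 2-isomorphisms $\widehat\xi(f):\mathcal G(f)\circ\xi_X\Rightarrow\xi_Y\circ\mathcal F(f)$, natural in $f$ and compatible with composition and identities; it is a pseudonatural isomorphism if all $\xi_X$ are invertible. A modification $\mathfrak n:\xi\Rightarrow\zeta$ is a family of 2-morphisms $\mathfrak n_X:\xi_X\Rightarrow\zeta_X$ with $\widehat\zeta(f)\cdot(1_{\mathcal G(f)}\circ\mathfrak n_X)=(\mathfrak n_Y\circ1_{\mathcal F(f)})\cdot\widehat\xi(f)$; a pseudomodification is such a family without this condition. Semigroupal 2-category. $(\mathcal C,\otimes,a,\pi)$ consists of a 2-category $\mathcal C$; a pseudofunctor $\otimes:\mathcal C\times\mathcal C\to\mathcal C$ with structural 2-isomorphisms $\widehat\otimes((f',g'),(f,g)):(f'\otimes g')\circ(f\otimes g)\Rightarrow(f'\circ f)\otimes(g'\circ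 g)$ and $\otimes_0(X,Y):id_X\otimes id_Y\Rightarrow id_{X\otimes Y}$; a pseudonatural isomorphism $a:\otimes\circ(id\times\otimes)\Rightarrow\otimes\circ(\otimes\times id)$ with components $a_{X,Y,Z}:X\otimes(Y\otimes Z)\to(X\otimes Y)\otimes Z$ and $\widehat a(f,g,h):((f\otimes g)\otimes h)\circ a_{X,Y,Z}\Rightarrow a_{X',Y',Z'}\circ(f\otimes(g\otimes h))$; and an invertible modification $\pi$ with components $\pi_{X,Y,Z,T}:(a_{X,Y,Z}\otimes id_T)\circ a_{X,Y\otimes Z,T}\circ(id_X\otimes a_{Y,Z,T})\Rightarrow a_{X\otimes Y,Z,T}\circ a_{X,Y,Z\otimes T}$ (source and target being pseudonatural with the structure pasted from $\widehat a$ and $\widehat\otimes$), such that the $K_5$ relation holds. Writing juxtaposition for $\otimes$, objects for identity 1-morphisms, and inserting $\widehat\otimes,\otimes_0$ where needed to match composites and identities, the $K_5$ relation says that the following two composites of whiskered 2-morphisms from $((a_{X,Y,Z}T)U)\circ(a_{X,YZ,T}U)\circ((Xa_{Y,Z,T})U)\circ a_{X,Y(ZT),U}\circ(Xa_{Y,ZT,U})\circ(X(Ya_{Z,T,U}))$ to $a_{(XY)Z,T,U}\circ a_{XY,Z,TU}\circ a_{X,Y,Z(TU)}$ are equal: (i) first $\pi_{X,Y,Z,T}\otimes1_{id_U}$, then $\pi_{X,Y,ZT,U}$, then $\widehat a(id_X,id_Y,a_{Z,T,U})^{-1}$, then $\pi_{XY,Z,T,U}$; (ii) first $\widehat a(id_X,a_{Y,Z,T},id_U)$,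 then $1_{id_X}\otimes\pi_{Y,Z,T,U}$, then $\pi_{X,YZ,T,U}$, then $\widehat a(a_{X,Y,Z},id_T,id_U)$, then $\pi_{X,Y,Z,TU}$. It is $K$-linear if $\mathcal C$ is $K$-linear and $(\tau,\sigma)\mapsto\tau\otimes\sigma$ is $K$-bilinear on 2-morphisms. Iterated products and reference paths. $\otimes^{(n)}$ and ${}^{(n)}\otimes$ are the completely right-, resp. left-parenthesized $n$-fold tensor product pseudofunctors $\mathcal C^n\to\mathcal C$ (for $n=1$ the identity, for $n=2$ $\otimes$). Pseudonatural isomorphisms $a^{(n)},{}^{(n)}a:\otimes^{(n)}\Rightarrow{}^{(n)}\otimes$: for $n=1,2$ identities, for $n=3$ both equal $a$, and for $n\ge4$ their 1-morphism components are $a^{(n)}_{X_1,\dots,X_n}=\big(\prod_{i=3}^n(\cdots(a_{X_1,{}^{(i-2)}\otimes(X_2,\dots,X_{i-1}),X_i}\otimes id_{X_{i+1}})\cdots)\otimes id_{X_n}\big)\circ(id_{X_1}\hat\otimes a^{(n-1)}_{X_2,\dots,X_n})$ and ${}^{(n)}a_{X_1,\dots,X_n}=\prod_{i=2}^{n-1}a_{{}^{(n-i)}\otimes(X_1,\dots,X_{n-i}),X_{n-i+1},\otimes^{(i-1)}(X_{n-i+2},\dots,X_n)}$, where products are composites of 1-morphisms written from left to right in increasing $i$ (so the largest $i$ is applied first) and $id_{X_1}\hat\otimes-$ means tensoring each composition factor by $id_{X_1}$; their 2-morphism components are the induced pastings of $\widehat a$'s and $\widehat\otimes$'s. Canonical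 2-isomorphisms and padding. An expansion of a 1-morphism is obtained by iterated tensoring with identity 1-morphisms on either side. An $a$-path is a (formal) composite of expansions of instances of $a_{X,Y,Z}$ between parenthesized tensor products of a given list of objects. A canonical 2-isomorphism between $a$-paths is a pasting of instances of the structural 2-isomorphisms $\widehat\otimes,\otimes_0,\widehat a,\pi$ (and inverses) and identity 2-morphisms of (expansions of instances of) the $a_{X,Y,Z}$; between two $a$-paths with the same source and target there is exactly one. If $\sigma:f\Rightarrow f'$ is a 2-morphism between $a$-paths among parenthesizations of $X_0,\dots,X_n$ (tensor products of an $a$-path with $id$ being regarded as $a$-paths through $\widehat\otimes$), then $\lceil\lceil\sigma\rceil\rceil:a^{(n+1)}_{X_0,\dots,X_n}\Rightarrow{}^{(n+1)}a_{X_0,\dots,X_n}$ is $\gamma'\cdot(1_{g'}\circ\sigma\circ1_g)\cdot\gamma$, where $g$ (resp. $g'$) is any $a$-path from $\otimes^{(n+1)}(X_0,\dots,X_n)$ to the source of $f$ (resp. from the target of $f$ to ${}^{(n+1)}\otimes(X_0,\dots,X_n)$), and $\gamma:a^{(n+1)}_{X_0,\dots,X_n}\Rightarrow g'\circ f\circ g$, $\gamma':g'\circ f'\circ g\Rightarrow{}^{(n+1)}a_{X_0,\dots,X_n}$ are canonical; it does not depend on $g,g'$. Complexes. For $n\ge0$, $\widetilde X^n_{pent}(\mathcal C)$ is the $K$-module of pseudomodifications from $a^{(n+1)}$ to ${}^{(n+1)}a$, and $X^n_{pent}(\mathcal C)\subset\widetilde X^n_{pent}(\mathcal C)$ that of modifications.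 The coboundary is $$(\delta_{pent}\mathfrak n)_{X_0,\dots,X_n}=\lceil\lceil1_{id_{X_0}}\otimes\mathfrak n_{X_1,\dots,X_n}\rceil\rceil+\sum_{i=1}^n(-1)^i\lceil\lceil\mathfrak n_{X_0,\dots,X_{i-1}\otimes X_i,\dots,X_n}\rceil\rceil+(-1)^{n+1}\lceil\lceil\mathfrak n_{X_0,\dots,X_{n-1}}\otimes1_{id_{X_n}}\rceil\rceil.$$ $H^\bullet_{pent}(\mathcal C)$ is the cohomology of $(X^\bullet_{pent}(\mathcal C),\delta_{pent})$. Deformations. $\mathcal C_\epsilon$ has the objects and 1-morphisms of $\mathcal C$ and 2-morphisms $\tau_0+\tau_1\epsilon$, $\epsilon^2=0$, with all operations (including $\otimes$) extended $K[\epsilon]/(\epsilon^2)$-bilinearly. A first order pentagonator-deformation is a family $(\pi_\epsilon)_{X,Y,Z,T}=\pi_{X,Y,Z,T}+(\pi^{(1)})_{X,Y,Z,T}\epsilon$ such that $\pi_\epsilon$ together with the (undeformed, extended) $\otimes,a$ makes $\mathcal C_\epsilon$ a semigroupal 2-category. Two of them, $\pi_\epsilon$ and $\pi'_\epsilon$, are $\omega$-equivalent if the identity 2-functor $(\mathcal C_\epsilon,\otimes,a,\pi_\epsilon)\to(\mathcal C_\epsilon,\otimes,a,\pi'_\epsilon)$ admits a semigroupal structure $(\psi,\omega)$ with $\psi$ the identity ($\psi_{X,Y}=id_{X\otimes Y}$, $\widehat\psi(f,g)=1_{f\otimes g}$) and $\omega_{X,Y,Z}\equiv(\otimes_0(X\otimes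 Y,Z)^{-1}\circ1_{a_{X,Y,Z}})\cdot(1_{a_{X,Y,Z}}\circ\otimes_0(X,Y\otimes Z))$ mod $\epsilon$. Here $\omega$ has components $\omega_{X,Y,Z}:a_{X,Y,Z}\circ(id_X\otimes id_{Y\otimes Z})\Rightarrow(id_{X\otimes Y}\otimes id_Z)\circ a_{X,Y,Z}$ and, with $\bar\omega_{X,Y,Z}=(\otimes_0(X\otimes Y,Z)\circ1)\cdot\omega_{X,Y,Z}\cdot(1\circ\otimes_0(X,Y\otimes Z)^{-1}):a_{X,Y,Z}\Rightarrow a_{X,Y,Z}$, the requirements on it are that $\bar\omega$ be an invertible modification $a\Rightarrow a$ and that $(\bar\omega_{X\otimes Y,Z,T}\circ\bar\omega_{X,Y,Z\otimes T})\cdot(\pi_\epsilon)_{X,Y,Z,T}=(\pi'_\epsilon)_{X,Y,Z,T}\cdot((\bar\omega_{X,Y,Z}\otimes1_{id_T})\circ\bar\omega_{X,Y\otimes Z,T}\circ(1_{id_X}\otimes\bar\omega_{Y,Z,T}))$. *)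

(* Defs.v *)
From HB Require Import structures.
From mathcomp Require Import all_boot all_algebra.
Set Implicit Arguments.
Unset Strict Implicit.
Unset Printing Implicit Defensive.
Import GRing.Theory.
Local Open Scope ring_scope.

(******************************************************************************)
(* Strict 2-categories are strict in the sense of Leibniz equality of          *)
(* 1-morphisms.  Since 2-morphisms are indexed by their source and target,     *)
(* the laws of horizontal composition are stated modulo the 2-morphisms        *)
(* [cast e], which are identities transported along an equality e : f = g      *)
(* between 1-morphisms.                                                        *)
(******************************************************************************)

Definition cast_of (K : comPzRingType) (ob : Type) (hom : ob -> ob -> Type)
    (hom2 : forall X Y, hom X Y -> hom X Y -> lmodType K)
    (id2 : forall X Y (f : hom X Y), hom2 X Y f f)
    X Y (f g : hom X Y) (e : f = g) : hom2 X Y f g :=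
  match e in _ = g' return hom2 X Y f g' with erefl => id2 X Y f end.

Record lin2cat (K : comPzRingType) := Lin2cat {
  ob :> Type;
  hom : ob -> ob -> Type;
  hom2 : forall X Y : ob, hom X Y -> hom X Y -> lmodType K;
  id1 : forall X, hom X X;
  comp1 : forall X Y Z, hom Y Z -> hom X Y -> hom X Z;
  id2 : forall X Y (f : hom X Y), hom2 f f;
  vcomp : forall X Y (f g h : hom X Y), hom2 g h -> hom2 f g -> hom2 f h;
  hcomp : forall X Y Z (g g' : hom Y Z) (f f' : hom X Y),
    hom2 g g' -> hom2 f f' -> hom2 (comp1 g f) (comp1 g' f');
  comp1A : forall X Y Z W (h : hom Z W) (g : hom Y Z) (f : hom X Y),
    comp1 h (comp1 g f) = comp1 (comp1 h g) f;
  comp1l : forall X Y (f : hom X Y), comp1 (id1 Y) f = f;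
  comp1r : forall X Y (f : hom X Y), comp1 f (id1 X) = f;
  vcompA : forall X Y (f g h k : hom X Y)
      (r : hom2 h k) (s : hom2 g h) (t : hom2 f g),
    vcomp r (vcomp s t) = vcomp (vcomp r s) t;
  vcompl : forall X Y (f g : hom X Y) (t : hom2 f g), vcomp (id2 g) t = t;
  vcompr : forall X Y (f g : hom X Y) (t : hom2 f g), vcomp t (id2 f) = t;
  hcomp_id2 : forall X Y Z (g : hom Y Z) (f : hom X Y),
    hcomp (id2 g) (id2 f) = id2 (comp1 g f);
  interchange : forall X Y Z (g g' g'' : hom Y Z) (f f' f'' : hom X Y)
      (t' : hom2 g' g'') (t : hom2 g g') (s' : hom2 f' f'') (s : hom2 f f'),
    hcomp (vcomp t' t) (vcomp s' s) = vcomp (hcomp t' s') (hcomp t s);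
  hcompA : forall X Y Z W (h h' : hom Z W) (g g' : hom Y Z) (f f' : hom X Y)
      (r : hom2 h h') (s : hom2 g g') (t : hom2 f f'),
    vcomp (cast_of id2 (comp1A h' g' f')) (hcomp r (hcomp s t))
    = vcomp (hcomp (hcomp r s) t) (cast_of id2 (comp1A h g f));
  hcompl : forall X Y (f f' : hom X Y) (t : hom2 f f'),
    vcomp (cast_of id2 (comp1l f')) (hcomp (id2 (id1 Y)) t)
    = vcomp t (cast_of id2 (comp1l f));
  hcompr : forall X Y (f f' : hom X Y) (t : hom2 f f'),
    vcomp (cast_of id2 (comp1r f')) (hcomp t (id2 (id1 X)))
    = vcomp t (cast_of id2 (comp1r f));
  vcomp_linl : forall X Y (f g h : hom X Y) (k : K)
      (t t' : hom2 g h) (s : hom2 f g),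
    vcomp (k *: t + t') s = k *: vcomp t s + vcomp t' s;
  vcomp_linr : forall X Y (f g h : hom X Y) (k : K)
      (t : hom2 g h) (s s' : hom2 f g),
    vcomp t (k *: s + s') = k *: vcomp t s + vcomp t s';
  hcomp_linl : forall X Y Z (g g' : hom Y Z) (f f' : hom X Y) (k : K)
      (t t' : hom2 g g') (s : hom2 f f'),
    hcomp (k *: t + t') s = k *: hcomp t s + hcomp t' s;
  hcomp_linr : forall X Y Z (g g' : hom Y Z) (f f' : hom X Y) (k : K)
      (t : hom2 g g') (s s' : hom2 f f'),
    hcomp t (k *: s + s') = k *: hcomp t s + hcomp t s'
}.

Arguments hom {K l} X Y.
Arguments hom2 {K l X Y} f g.
Arguments id1 {K l} X.
Arguments comp1 {K l X Y Z} g f.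
Arguments id2 {K l X Y} f.
Arguments vcomp {K l X Y f g h} t s.
Arguments hcomp {K l X Y Z g g' f f'} t s.
Arguments comp1A {K l X Y Z W} h g f.
Arguments comp1l {K l X Y} f.
Arguments comp1r {K l X Y} f.

Declare Scope twocat_scope.
Delimit Scope twocat_scope with C2.
Local Open Scope twocat_scope.
Notation "g ∘ f" := (comp1 g f) (at level 40, left associativity) : twocat_scope.
Notation "t ⋆ s" := (hcomp t s) (at level 40, left associativity) : twocat_scope.
Notation "t • s" := (vcomp t s) (at level 42, left associativity) : twocat_scope.
Notation cast e := (cast_of (@id2 _ _) e).

Section Invertible.
Context {K : comPzRingType} {C : lin2cat K}.

Definition invertible1 (X Y : C) (f : hom X Y) : Prop :=
  exists g : hom Y X, g ∘ f = id1 X /\ f ∘ g = id1 Y.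

Definition invertible2 (X Y : C) (f g : hom X Y) (t : hom2 f g) : Prop :=
  exists s : hom2 g f, s • t = id2 f /\ t • s = id2 g.

Record iso2 (X Y : C) (f g : hom X Y) := Iso2 {
  fw :> hom2 f g;
  bw : hom2 g f;
  fwK : bw • fw = id2 f;
  bwK : fw • bw = id2 g
}.

Lemma cast_fwK (X Y : C) (f g : hom X Y) (e : f = g) :
  cast (esym e) • cast e = id2 f.
Proof. by case: _ / e; rewrite /= vcompl. Qed.

Lemma cast_bwK (X Y : C) (f g : hom X Y) (e : f = g) :
  cast e • cast (esym e) = id2 g.
Proof. by case: _ / e; rewrite /= vcompl. Qed.

Lemma vcompKK (X Y : C) (f g h : hom X Y) (t : hom2 g h) (t' : hom2 h g)
    (s : hom2 f g) (s' : hom2 g f) :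
  t' • t = id2 g -> s' • s = id2 f -> (s' • t') • (t • s) = id2 f.
Proof. by move=> tK sK; rewrite -vcompA (vcompA t') tK vcompl. Qed.

Lemma hcompKK (X Y Z : C) (g g' : hom Y Z) (f f' : hom X Y)
    (t : hom2 g g') (t' : hom2 g' g) (s : hom2 f f') (s' : hom2 f' f) :
  t' • t = id2 g -> s' • s = id2 f -> (t' ⋆ s') • (t ⋆ s) = id2 (g ∘ f).
Proof. by move=> tK sK; rewrite -interchange tK sK hcomp_id2. Qed.

Definition icast (X Y : C) (f g : hom X Y) (e : f = g) : iso2 f g :=
  Iso2 (cast_fwK e) (cast_bwK e).
Definition iid (X Y : C) (f : hom X Y) : iso2 f f :=
  Iso2 (vcompl (id2 f)) (vcompl (id2 f)).
Definition iinv (X Y : C) (f g : hom X Y) (t : iso2 f g) : iso2 g f :=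
  Iso2 (bwK t) (fwK t).
Definition ivcomp (X Y : C) (f g h : hom X Y) (t : iso2 g h) (s : iso2 f g) :
    iso2 f h :=
  Iso2 (vcompKK (fwK t) (fwK s)) (vcompKK (bwK s) (bwK t)).
Definition ihcomp (X Y Z : C) (g g' : hom Y Z) (f f' : hom X Y)
    (t : iso2 g g') (s : iso2 f f') : iso2 (g ∘ f) (g' ∘ f') :=
  Iso2 (hcompKK (fwK t) (fwK s)) (hcompKK (bwK t) (bwK s)).

End Invertible.

(* A pseudofunctor C x C -> C, K-bilinear on 2-morphisms.                     *)
Record tensor (K : comPzRingType) (C : lin2cat K) := Tensor {
  to : C -> C -> C;
  t1 : forall X X' Y Y' : C, hom X X' -> hom Y Y' -> hom (to X Y) (to X' Y');
  t2 : forall (X X' Y Y' : C) (f f' : hom X X') (g g' : hom Y Y'),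
    hom2 f f' -> hom2 g g' -> hom2 (t1 f g) (t1 f' g');
  th : forall (X X' X'' Y Y' Y'' : C)
      (f' : hom X' X'') (g' : hom Y' Y'') (f : hom X X') (g : hom Y Y'),
    iso2 (t1 f' g' ∘ t1 f g) (t1 (f' ∘ f) (g' ∘ g));
  t0 : forall X Y : C, iso2 (t1 (id1 X) (id1 Y)) (id1 (to X Y));
  t2_id2 : forall (X X' Y Y' : C) (f : hom X X') (g : hom Y Y'),
    t2 (id2 f) (id2 g) = id2 (t1 f g);
  t2_vcomp : forall (X X' Y Y' : C) (f f' f'' : hom X X') (g g' g'' : hom Y Y')
      (t' : hom2 f' f'') (t : hom2 f f') (s' : hom2 g' g'') (s : hom2 g g'),
    t2 (t' • t) (s' • s) = t2 t' s' • t2 t s;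
  t2_linl : forall (X X' Y Y' : C) (f f' : hom X X') (g g' : hom Y Y') (k : K)
      (t t' : hom2 f f') (s : hom2 g g'),
    t2 (k *: t + t') s = k *: t2 t s + t2 t' s;
  t2_linr : forall (X X' Y Y' : C) (f f' : hom X X') (g g' : hom Y Y') (k : K)
      (t : hom2 f f') (s s' : hom2 g g'),
    t2 t (k *: s + s') = k *: t2 t s + t2 t s';
  th_nat : forall (X X' X'' Y Y' Y'' : C)
      (f' h' : hom X' X'') (g' k' : hom Y' Y'')
      (f h : hom X X') (g k : hom Y Y')
      (t' : hom2 f' h') (s' : hom2 g' k') (t : hom2 f h) (s : hom2 g k),
    th h' k' h k • (t2 t' s' ⋆ t2 t s) = t2 (t' ⋆ t) (s' ⋆ s) • th f' g' f g;
  th_assoc : forall (X X' X'' X''' Y Y' Y'' Y''' : C)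
      (f'' : hom X'' X''') (g'' : hom Y'' Y''')
      (f' : hom X' X'') (g' : hom Y' Y'') (f : hom X X') (g : hom Y Y'),
    t2 (cast (comp1A f'' f' f)) (cast (comp1A g'' g' g))
      • (th f'' g'' (f' ∘ f) (g' ∘ g) • (id2 (t1 f'' g'') ⋆ th f' g' f g))
    = th (f'' ∘ f') (g'' ∘ g') f g • (th f'' g'' f' g' ⋆ id2 (t1 f g))
      • cast (comp1A (t1 f'' g'') (t1 f' g') (t1 f g));
  th_unitl : forall (X X' Y Y' : C) (f : hom X X') (g : hom Y Y'),
    t2 (cast (comp1l f)) (cast (comp1l g)) • th (id1 X') (id1 Y') f g
    = cast (comp1l (t1 f g)) • (t0 X' Y' ⋆ id2 (t1 f g));
  th_unitr : forall (X X' Y Y' : C) (f : hom X X') (g : hom Y Y'),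
    t2 (cast (comp1r f)) (cast (comp1r g)) • th f g (id1 X) (id1 Y)
    = cast (comp1r (t1 f g)) • (id2 (t1 f g) ⋆ t0 X Y)
}.

Arguments to {K C} T X Y : rename.
Arguments t1 {K C} T {X X' Y Y'} f g : rename.
Arguments t2 {K C} T {X X' Y Y' f f' g g'} s t : rename.
Arguments th {K C} T {X X' X'' Y Y' Y''} f' g' f g : rename.
Arguments t0 {K C} T X Y : rename.

Section Tensor3.
Context {K : comPzRingType} {C : lin2cat K} (T : tensor C).

Lemma t2KK (X X' Y Y' : C) (f f' : hom X X') (g g' : hom Y Y')
    (t : hom2 f f') (t' : hom2 f' f) (s : hom2 g g') (s' : hom2 g' g) :
  t' • t = id2 f -> s' • s = id2 g -> t2 T t' s' • t2 T t s = id2 (t1 T f g).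
Proof. by move=> tK sK; rewrite -t2_vcomp tK sK t2_id2. Qed.

Definition it2 (X X' Y Y' : C) (f f' : hom X X') (g g' : hom Y Y')
    (t : iso2 f f') (s : iso2 g g') : iso2 (t1 T f g) (t1 T f' g') :=
  Iso2 (t2KK (fwK t) (fwK s)) (t2KK (bwK t) (bwK s)).

(* Structural 2-morphisms of the two triple tensor product pseudofunctors.    *)
Definition thL (X X' X'' Y Y' Y'' Z Z' Z'' : C)
    (f' : hom X' X'') (g' : hom Y' Y'') (h' : hom Z' Z'')
    (f : hom X X') (g : hom Y Y') (h : hom Z Z') :
    hom2 (t1 T (t1 T f' g') h' ∘ t1 T (t1 T f g) h)
         (t1 T (t1 T (f' ∘ f) (g' ∘ g)) (h' ∘ h)) :=
  t2 T (th T f' g' f g) (id2 (h' ∘ h)) • th T (t1 T f' g') h' (t1 T f g) h.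

Definition thR (X X' X'' Y Y' Y'' Z Z' Z'' : C)
    (f' : hom X' X'') (g' : hom Y' Y'') (h' : hom Z' Z'')
    (f : hom X X') (g : hom Y Y') (h : hom Z Z') :
    hom2 (t1 T f' (t1 T g' h') ∘ t1 T f (t1 T g h))
         (t1 T (f' ∘ f) (t1 T (g' ∘ g) (h' ∘ h))) :=
  t2 T (id2 (f' ∘ f)) (th T g' h' g h) • th T f' (t1 T g' h') f (t1 T g h).

Definition t0L (X Y Z : C) :
    hom2 (t1 T (t1 T (id1 X) (id1 Y)) (id1 Z)) (id1 (to T (to T X Y) Z)) :=
  t0 T (to T X Y) Z • t2 T (t0 T X Y) (id2 (id1 Z)).

Definition t0R (X Y Z : C) :
    hom2 (t1 T (id1 X) (t1 T (id1 Y) (id1 Z))) (id1 (to T X (to T Y Z))) :=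
  t0 T X (to T Y Z) • t2 T (id2 (id1 X)) (t0 T Y Z).

End Tensor3.

(* A pseudonatural isomorphism from X,Y,Z |-> X(YZ) to X,Y,Z |-> (XY)Z.       *)
Record associator (K : comPzRingType) (C : lin2cat K) (T : tensor C) :=
  Associator {
  as1 : forall X Y Z : C, hom (to T X (to T Y Z)) (to T (to T X Y) Z);
  ah : forall (X X' Y Y' Z Z' : C) (f : hom X X') (g : hom Y Y') (h : hom Z Z'),
    iso2 (t1 T (t1 T f g) h ∘ as1 X Y Z) (as1 X' Y' Z' ∘ t1 T f (t1 T g h));
  as1_inv : forall X Y Z, invertible1 (as1 X Y Z);
  ah_nat : forall (X X' Y Y' Z Z' : C)
      (f f' : hom X X') (g g' : hom Y Y') (h h' : hom Z Z')
      (r : hom2 f f') (s : hom2 g g') (t : hom2 h h'),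
    ah f' g' h' • (t2 T (t2 T r s) t ⋆ id2 (as1 X Y Z))
    = (id2 (as1 X' Y' Z') ⋆ t2 T r (t2 T s t)) • ah f g h;
  ah_comp : forall (X X' X'' Y Y' Y'' Z Z' Z'' : C)
      (f' : hom X' X'') (g' : hom Y' Y'') (h' : hom Z' Z'')
      (f : hom X X') (g : hom Y Y') (h : hom Z Z'),
    ah (f' ∘ f) (g' ∘ g) (h' ∘ h) • (thL T f' g' h' f g h ⋆ id2 (as1 X Y Z))
    = (id2 (as1 X'' Y'' Z'') ⋆ thR T f' g' h' f g h)
      • cast (esym (comp1A _ _ _))
      • (ah f' g' h' ⋆ id2 (t1 T f (t1 T g h)))
      • cast (comp1A _ _ _)
      • (id2 (t1 T (t1 T f' g') h') ⋆ ah f g h)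
      • cast (esym (comp1A _ _ _));
  ah_unit : forall X Y Z : C,
    cast (comp1r _) • (id2 (as1 X Y Z) ⋆ t0R T X Y Z)
      • ah (id1 X) (id1 Y) (id1 Z)
    = cast (comp1l _) • (t0L T X Y Z ⋆ id2 (as1 X Y Z))
}.

Arguments as1 {K C T} a X Y Z : rename.
Arguments ah {K C T} a {X X' Y Y' Z Z'} f g h : rename.

(******************************************************************************)
(* Formal parenthesized products of objects labelled by A, and formal          *)
(* composites of tensor products of instances of a and identities; the         *)
(* latter are a-paths through \hat\otimes and \otimes_0.                        *)
(******************************************************************************)

Inductive tree (A : Type) := Lf (x : A) | Nd (t u : tree A).

Inductive apath (A : Type) : tree A -> tree A -> Type :=
| Pa t u v : apath (Nd t (Nd u v)) (Nd (Nd t u) v)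
| Pid t : apath t t
| Pcomp s t u : apath t u -> apath s t -> apath s u
| Ptens s t s' t' : apath s t -> apath s' t' -> apath (Nd s s') (Nd t t').

Arguments Pid {A} t.
Arguments Pa {A} t u v.

Declare Scope apath_scope.
Delimit Scope apath_scope with AP.
Bind Scope apath_scope with apath.
Notation "n ∘ m" := (Pcomp n m) : apath_scope.
Notation "m ⊗ n" := (Ptens m n) (at level 35, right associativity) : apath_scope.
Notation "m ◁ t" := (Ptens m (Pid t)) (at level 35, t at level 0) : apath_scope.
Notation "t ▷ m" := (Ptens (Pid t) m) (at level 35, m at level 0) : apath_scope.

(******************************************************************************)
(* The completely right and left parenthesized products and the a-paths        *)
(* a^(n), (n)a between them, for the n objects x :: s.                         *)
(******************************************************************************)
Section Iterated.
Context {A : Type}.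
Implicit Types (x y : tree A) (s : seq (tree A)).

Fixpoint rtree x s : tree A := if s is y :: s' then Nd x (rtree y s') else x.
Fixpoint ltree x s : tree A := if s is y :: s' then ltree (Nd x y) s' else x.

Fixpoint expandr s t u (m : apath t u) : apath (ltree t s) (ltree u s) :=
  match s with
  | [::] => m
  | x :: s' => expandr s' (Ptens m (Pid x))
  end.

(* tensoring each composition factor by x *)
Fixpoint ltens x t u (m : apath t u) : apath (Nd x t) (Nd x u) :=
  match m in apath t u return apath (Nd x t) (Nd x u) with
  | Pcomp _ _ _ n m => Pcomp (ltens x n) (ltens x m)
  | Pa _ _ _ as m | Pid _ as m | Ptens _ _ _ _ _ _ as m => Ptens (Pid x) m
  end.

(* Composes m with the a_{x, (i-2)(y, ..), z_i}, expanded on the right by the  *)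
(* remaining objects, for z_i in s, the last one being applied first.          *)
Fixpoint shift r x y s :
    apath r (Nd x (ltree y s)) -> apath r (ltree (Nd x y) s) :=
  match s with
  | [::] => fun m => m
  | z :: s' => fun m => Pcomp (expandr s' (Pa x y z)) (shift (y := Nd y z) m)
  end.

Fixpoint an x s : apath (rtree x s) (ltree x s) :=
  match s with
  | [::] => Pid x
  | y :: s1 =>
    match s1 return
      apath (rtree y s1) (ltree y s1) ->
      apath (rtree x (y :: s1)) (ltree x (y :: s1))
    with
    | [::] => fun=> Pid (Nd x y)
    | [:: z] => fun=> Pa x y z
    | _ => fun m => shift (ltens x m)
    end (an y s1)
  end.

Fixpoint na x s : apath (rtree x s) (ltree x s) :=
  match s with
  | [::] => Pid x
  | y :: s1 =>
    match s1 return
      apath (rtree (Nd x y) s1) (ltree (Nd x y) s1) ->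
      apath (rtree x (y :: s1)) (ltree x (y :: s1))
    with
    | [::] => fun=> Pid (Nd x y)
    | [:: z] => fun=> Pa x y z
    | z :: s2 => fun m => Pcomp m (Pa x y (rtree z s2))
    end (na (Nd x y) s1)
  end.

End Iterated.

(* Syntax of canonical 2-isomorphisms.                                        *)
Inductive cell (A : Type) :
    forall s t : tree A, apath s t -> apath s t -> Type :=
| Cid s t (m : apath s t) : cell m m
| Cinv s t (m m' : apath s t) : cell m m' -> cell m' m
| Cv s t (m m' m'' : apath s t) : cell m' m'' -> cell m m' -> cell m m''
| Ch s t u (n n' : apath t u) (m m' : apath s t) :
    cell n n' -> cell m m' -> cell (n ∘ m) (n' ∘ m')
| Ct s t s' t' (m n : apath s t) (m' n' : apath s' t') :
    cell m n -> cell m' n' -> cell (m ⊗ m') (n ⊗ n')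
| CA s t u v (p : apath u v) (n : apath t u) (m : apath s t) :
    cell (p ∘ (n ∘ m)) ((p ∘ n) ∘ m)
| Cl s t (m : apath s t) : cell (Pid t ∘ m) m
| Cr s t (m : apath s t) : cell (m ∘ Pid s) m
| Cth s t u s' t' u'
    (n : apath t u) (n' : apath t' u') (m : apath s t) (m' : apath s' t') :
    cell ((n ⊗ n') ∘ (m ⊗ m')) ((n ∘ m) ⊗ (n' ∘ m'))
| Ct0 s t : cell (Pid s ⊗ Pid t) (Pid (Nd s t))
| Cah s t s' t' s'' t''
    (m : apath s t) (m' : apath s' t') (m'' : apath s'' t'') :
    cell (((m ⊗ m') ⊗ m'') ∘ Pa s s' s'') (Pa t t' t'' ∘ (m ⊗ (m' ⊗ m'')))
| Cpi x y z t : cell (an x [:: y; z; t]) (na x [:: y; z; t]).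

Arguments Cid {A s t m}.
Arguments CA {A s t u v p n m}.
Arguments Cl {A s t m}.
Arguments Cr {A s t m}.
Arguments Cth {A s t u s' t' u' n n' m m'}.

Declare Scope cell_scope.
Delimit Scope cell_scope with CE.
Bind Scope cell_scope with cell.
Notation "c • d" := (Cv c d) : cell_scope.
Notation "c ⋆ d" := (Ch c d) : cell_scope.
Notation "c ⊗ d" := (Ct c d) : cell_scope.

Section Evaluation.
Context {K : comPzRingType} {C : lin2cat K} {T : tensor C} (a : associator T).

Section Labels.
Context {A : Type} (o : A -> C).

Fixpoint tob (t : tree A) : C :=
  match t with Lf x => o x | Nd t u => to T (tob t) (tob u) end.

Fixpoint ev (s t : tree A) (m : apath s t) : hom (tob s) (tob t) :=
  match m in apath s t return hom (tob s) (tob t) with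
  | Pa t u v => as1 a (tob t) (tob u) (tob v)
  | Pid t => id1 (tob t)
  | Pcomp _ _ _ n m => (ev n ∘ ev m)%C2
  | Ptens _ _ _ _ m n => t1 T (ev m) (ev n)
  end.

End Labels.

Notation evo := (ev (fun X : C => X)).
Notation tobo := (tob (fun X : C => X)).

Definition pi_source (X Y Z W : C) := evo (an (Lf X) [:: Lf Y; Lf Z; Lf W]).
Definition pi_target (X Y Z W : C) := evo (na (Lf X) [:: Lf Y; Lf Z; Lf W]).

Lemma pi_sourceE (X Y Z W : C) :
  pi_source X Y Z W
  = (t1 T (as1 a X Y Z) (id1 W)
      ∘ (as1 a X (to T Y Z) W ∘ t1 T (id1 X) (as1 a Y Z W)))%C2.
Proof. by []. Qed.

Lemma pi_targetE (X Y Z W : C) :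
  pi_target X Y Z W
  = (as1 a (to T X Y) Z W ∘ as1 a X Y (to T Z W))%C2.
Proof. by []. Qed.

Definition pi_data :=
  forall X Y Z W : C, iso2 (pi_source X Y Z W) (pi_target X Y Z W).

Fixpoint evc (P : pi_data) (s t : tree C) (m m' : apath s t) (c : cell m m') :
    iso2 (evo m) (evo m') :=
  match c in @cell _ s t m m' return iso2 (evo m) (evo m') with
  | Cid _ _ m => iid (evo m)
  | Cinv _ _ _ _ c => iinv (evc P c)
  | Cv _ _ _ _ _ c d => ivcomp (evc P c) (evc P d)
  | Ch _ _ _ _ _ _ _ c d => ihcomp (evc P c) (evc P d)
  | Ct _ _ _ _ _ _ _ _ c d => it2 T (evc P c) (evc P d)
  | CA _ _ _ _ p n m => icast (comp1A (evo p) (evo n) (evo m))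
  | Cl _ _ m => icast (comp1l (evo m))
  | Cr _ _ m => icast (comp1r (evo m))
  | Cth _ _ _ _ _ _ n n' m m' => th T (evo n) (evo n') (evo m) (evo m')
  | Ct0 s t => t0 T (tobo s) (tobo t)
  | Cah _ _ _ _ _ _ m m' m'' => ah a (evo m) (evo m') (evo m'')
  | Cpi x y z t => P (tobo x) (tobo y) (tobo z) (tobo t)
  end.

(* The pseudonaturality 2-morphisms of an a-path, pasted from those of a and  *)
(* of the tensor product; the leaves carry the 1-morphisms at which they are  *)
(* taken.                                                                     *)
Record arr := Arr { src : C; tgt : C; mor : hom src tgt }.

Fixpoint tmor (t : tree arr) : hom (tob src t) (tob tgt t) :=
  match t return hom (tob src t) (tob tgt t) with
  | Lf f => mor f
  | Nd t u => t1 T (tmor t) (tmor u)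
  end.

Fixpoint hat (s t : tree arr) (m : apath s t) :
    hom2 (tmor t ∘ ev src m) (ev tgt m ∘ tmor s) :=
  match m in apath s t
    return hom2 (tmor t ∘ ev src m) (ev tgt m ∘ tmor s) with
  | Pa t u v => ah a (tmor t) (tmor u) (tmor v)
  | Pid t => cast (esym (comp1l (tmor t))) • cast (comp1r (tmor t))
  | Pcomp s t u n m =>
      cast (comp1A (ev tgt n) (ev tgt m) (tmor s))
      • (id2 (ev tgt n) ⋆ hat m)
      • cast (esym (comp1A (ev tgt n) (tmor t) (ev src m)))
      • (hat n ⋆ id2 (ev src m))
      • cast (comp1A (tmor u) (ev src n) (ev src m))
  | Ptens s t s' t' m n =>
      bw (th T (ev tgt m) (ev tgt n) (tmor s) (tmor s'))
      • t2 T (hat m) (hat n)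
      • th T (tmor t) (tmor t') (ev src m) (ev src n)
  end.

(* The modification square for a 2-morphism between a-paths from m to m' with *)
(* component k at the sources and k' at the targets of the labels.            *)
Definition mod_square (r s : tree arr) (m m' : apath r s)
    (k : hom2 (ev src m) (ev src m')) (k' : hom2 (ev tgt m) (ev tgt m')) :=
  hat m' • (id2 (tmor s) ⋆ k) = (k' ⋆ id2 (tmor r)) • hat m.

End Evaluation.

Notation evo a := (ev a (fun X => X)).
Arguments Arr {K C src tgt} mor.

(******************************************************************************)
(* The padding gamma' . (1_{g'} o sigma o 1_g) . gamma, and its syntactic      *)
(* version when sigma is itself canonical.  Canonical 2-isomorphisms between   *)
(* given a-paths being unique, the padding depends neither on g, g' nor on the *)
(* cells c, c'; the coboundary below uses one explicit choice for each term.   *)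
(******************************************************************************)
Definition cpad (A : Type) (s s' t' t : tree A) (p q : apath s t)
    (g : apath s s') (f f' : apath s' t') (g' : apath t' t)
    (c : cell p (g' ∘ (f ∘ g))) (k : cell f f') (c' : cell (g' ∘ (f' ∘ g)) q) :
    cell p q :=
  (c' • (Cid ⋆ (k ⋆ Cid)) • c)%CE.

Definition pad (K : comPzRingType) (C : lin2cat K) (T : tensor C)
    (a : associator T) (P : pi_data a)
    (s s' t' t : tree C) (p q : apath s t)
    (g : apath s s') (f f' : apath s' t') (g' : apath t' t)
    (c : cell p (g' ∘ (f ∘ g))) (c' : cell (g' ∘ (f' ∘ g)) q)
    (k : hom2 (evo a f) (evo a f')) : hom2 (evo a p) (evo a q) :=
  evc P c' • (id2 (evo a g') ⋆ (k ⋆ id2 (evo a g))) • evc P c.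

Section CanonicalCells.
Context {A : Type}.
Implicit Types (x y z t u r s v w : tree A).
Local Open Scope cell_scope.

Definition assoc3 r s v w t (p : apath w t) (n : apath v w) (m : apath s v)
    (k : apath r s) : cell (p ∘ (n ∘ (m ∘ k))) ((p ∘ (n ∘ m)) ∘ k) :=
  CA • (Cid ⋆ CA).

Definition fuser u r s v (n : apath s v) (m : apath r s) :
    cell ((n ◁ u) ∘ (m ◁ u)) ((n ∘ m) ◁ u) :=
  (Cid ⊗ Cl) • Cth.

Definition fusel u r s v (n : apath s v) (m : apath r s) :
    cell ((u ▷ n) ∘ (u ▷ m)) (u ▷ (n ∘ m)) :=
  (Cl ⊗ Cid) • Cth.

Definition fuser3 u r s v w (p : apath v w) (n : apath s v) (m : apath r s) :
    cell ((p ◁ u) ∘ ((n ◁ u) ∘ (m ◁ u))) ((p ∘ (n ∘ m)) ◁ u) :=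
  fuser u p (n ∘ m) • (Cid ⋆ fuser u n m).

Definition fusel3 u r s v w (p : apath v w) (n : apath s v) (m : apath r s) :
    cell ((u ▷ p) ∘ ((u ▷ n) ∘ (u ▷ m))) (u ▷ (p ∘ (n ∘ m))) :=
  fusel u p (n ∘ m) • (Cid ⋆ fusel u n m).

(* c4_j and d4_j are the 2-isomorphisms gamma and gamma' that pad the j-th    *)
(* term of the coboundary in degree 2.                                        *)
Section K4.
Context (x y z t : tree A).
Let a4 := an x [:: y; z; t].
Let b4 := na x [:: y; z; t].

Definition c4_0 :
    cell a4 (((Pa x y z ◁ t) ∘ Pa x (Nd y z) t) ∘ ((x ▷ (Pa y z t)) ∘ Pid _)) :=
  (Cid ⋆ Cinv Cr) • CA.
Definition d4_0 :
    cell (((Pa x y z ◁ t) ∘ Pa x (Nd y z) t) ∘ ((x ▷ (Pa y z t)) ∘ Pid _)) b4 :=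
  Cpi x y z t • Cinv c4_0.

Definition d4_1 : cell (Pid _ ∘ (Pa (Nd x y) z t ∘ Pa x y (Nd z t))) b4 := Cl.
Definition c4_1 : cell a4 (Pid _ ∘ (Pa (Nd x y) z t ∘ Pa x y (Nd z t))) :=
  Cinv d4_1 • Cpi x y z t.

Definition c4_2 :
    cell a4 ((Pa x y z ◁ t) ∘ (Pa x (Nd y z) t ∘ (x ▷ (Pa y z t)))) := Cid.
Definition d4_2 :
    cell ((Pa x y z ◁ t) ∘ (Pa x (Nd y z) t ∘ (x ▷ (Pa y z t)))) b4 :=
  Cpi x y z t.

Definition d4_3 : cell (Pa (Nd x y) z t ∘ (Pa x y (Nd z t) ∘ Pid _)) b4 :=
  Cid ⋆ Cr.
Definition c4_3 : cell a4 (Pa (Nd x y) z t ∘ (Pa x y (Nd z t) ∘ Pid _)) :=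
  Cinv d4_3 • Cpi x y z t.

Definition c4_4 :
    cell a4 (Pid _ ∘ ((Pa x y z ◁ t) ∘ (Pa x (Nd y z) t ∘ (x ▷ (Pa y z t))))) :=
  Cinv Cl.
Definition d4_4 :
    cell (Pid _ ∘ ((Pa x y z ◁ t) ∘ (Pa x (Nd y z) t ∘ (x ▷ (Pa y z t))))) b4 :=
  Cpi x y z t • Cl.

End K4.

(* The two composites in the K_5 relation go through                          *)
(*   k5_source => l1 => l2 => l3 => b5                                        *)
(*   k5_source => a5 => r2 => r3 => r4 => b5,                                 *)
(* where the steps named after four objects are padded pentagonators and the  *)
(* steps nat_i are instances of the pseudonaturality of a in its argument i.  *)
Section K5.
Context (x y z t u : tree A).
Let a5 := an x [:: y; z; t; u].
Let b5 := na x [:: y; z; t; u].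
Let xy := Nd x y.
Let yz := Nd y z.
Let zt := Nd z t.
Let tu := Nd t u.

Definition k5_source :
    apath (rtree x [:: y; z; t; u]) (ltree x [:: y; z; t; u]) :=
  (((Pa x y z ◁ t) ◁ u) ∘ ((Pa x yz t ◁ u) ∘ (((x ▷ (Pa y z t)) ◁ u) ∘
    (Pa x (Nd y zt) u ∘ ((x ▷ (Pa y zt u)) ∘ (x ▷ (y ▷ (Pa z t u)))))))) %AP.

Let e := (x ▷ (y ▷ (Pa z t u)))%AP.
Let g1 := (Pa x (Nd y zt) u ∘ ((x ▷ (Pa y zt u)) ∘ e))%AP.
Let l1 := ((Pa xy z t ◁ u) ∘ ((Pa x y zt ◁ u) ∘ g1))%AP.
Let l2 := ((Pa xy z t ◁ u) ∘ (Pa xy zt u ∘ (Pa x y (Nd zt u) ∘ e)))%AP.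
Let l3 := ((Pa xy z t ◁ u) ∘ (Pa xy zt u ∘
            ((xy ▷ (Pa z t u)) ∘ Pa x y (Nd z tu))))%AP.

Definition pre_xyzt : cell k5_source (Pid _ ∘ ((an x [:: y; z; t] ◁ u) ∘ g1)) :=
  Cinv Cl • ((fuser3 u _ _ _ ⋆ Cid) • assoc3 _ _ _ _).
Definition post_xyzt : cell (Pid _ ∘ ((na x [:: y; z; t] ◁ u) ∘ g1)) l1 :=
  Cinv CA • ((Cinv (fuser u _ _) ⋆ Cid) • Cl).
Definition pi_xyzt : cell k5_source l1 :=
  cpad pre_xyzt (Cpi x y z t ⊗ Cid) post_xyzt.

Definition pre_x_y_zt_u :
    cell l1 ((Pa xy z t ◁ u) ∘ (an x [:: y; zt; u] ∘ e)) :=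
  Cid ⋆ assoc3 _ _ _ _.
Definition post_x_y_zt_u :
    cell ((Pa xy z t ◁ u) ∘ (na x [:: y; zt; u] ∘ e)) l2 :=
  Cid ⋆ Cinv CA.
Definition pi_x_y_zt_u : cell l1 l2 :=
  cpad pre_x_y_zt_u (Cpi x y zt u) post_x_y_zt_u.

Definition nat_3 : cell l2 l3 :=
  Cid ⋆ (Cid ⋆ (((Ct0 x y ⊗ Cid) ⋆ Cid) •
    Cinv (Cah (Pid x) (Pid y) (Pa z t u)))).

Definition pre_xy_z_t_u :
    cell l3 (Pid _ ∘ (an xy [:: z; t; u] ∘ Pa x y (Nd z tu))) :=
  Cinv Cl • assoc3 _ _ _ _.
Definition post_xy_z_t_u :
    cell (Pid _ ∘ (na xy [:: z; t; u] ∘ Pa x y (Nd z tu))) b5 :=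
  Cl.
Definition pi_xy_z_t_u : cell l3 b5 :=
  cpad pre_xy_z_t_u (Cpi xy z t u) post_xy_z_t_u.

Definition k5_side1 : cell k5_source b5 :=
  pi_xy_z_t_u • (nat_3 • (pi_x_y_zt_u • pi_xyzt)).

Let p := ((Pa x y z ◁ t) ◁ u)%AP.
Let q := (Pa x yz t ◁ u)%AP.
Let q' := Pa x (Nd yz t) u.
Let h := (x ▷ (Pa y z tu))%AP.
Let r2 := (p ∘ (q ∘ (q' ∘ ((x ▷ (Pa yz t u)) ∘ h))))%AP.
Let r3 := (p ∘ (Pa (Nd x yz) t u ∘ (Pa x yz tu ∘ h)))%AP.
Let r4 := (Pa (Nd xy z) t u ∘ ((Pa x y z ◁ tu) ∘ (Pa x yz tu ∘ h)))%AP.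

Definition nat_2 : cell k5_source a5 :=
  Cid ⋆ (Cid ⋆ (Cinv CA • ((Cah (Pid x) (Pa y z t) (Pid u) ⋆ Cid) • CA))).

Definition pre_yztu :
    cell a5 ((p ∘ (q ∘ q')) ∘ ((x ▷ (an y [:: z; t; u])) ∘ Pid _)) :=
  (Cid ⋆ Cinv Cr) • (assoc3 _ _ _ _ • (Cid ⋆ (Cid ⋆ (Cid ⋆ fusel3 x _ _ _)))).
Definition post_yztu :
    cell ((p ∘ (q ∘ q')) ∘ ((x ▷ (na y [:: z; t; u])) ∘ Pid _)) r2 :=
  (Cid ⋆ (Cid ⋆ (Cid ⋆ Cinv (fusel x _ _))))
  • (Cinv (assoc3 _ _ _ _) • (Cid ⋆ Cr)).
Definition pi_yztu : cell a5 r2 :=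
  cpad pre_yztu (Cid ⊗ Cpi y z t u) post_yztu.

Definition pre_x_yz_t_u : cell r2 (p ∘ (an x [:: yz; t; u] ∘ h)) :=
  Cid ⋆ assoc3 _ _ _ _.
Definition post_x_yz_t_u : cell (p ∘ (na x [:: yz; t; u] ∘ h)) r3 :=
  Cid ⋆ Cinv CA.
Definition pi_x_yz_t_u : cell r2 r3 :=
  cpad pre_x_yz_t_u (Cpi x yz t u) post_x_yz_t_u.

Definition nat_1 : cell r3 r4 :=
  Cinv CA
  • ((((Cid ⋆ (Cid ⊗ Ct0 t u)) • Cah (Pa x y z) (Pid t) (Pid u)) ⋆ Cid) • CA).

Definition pre_x_y_z_tu :
    cell r4 (Pa (Nd xy z) t u ∘ (an x [:: y; z; tu] ∘ Pid _)) :=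
  Cid ⋆ Cinv Cr.
Definition post_x_y_z_tu :
    cell (Pa (Nd xy z) t u ∘ (na x [:: y; z; tu] ∘ Pid _)) b5 :=
  CA • (Cid ⋆ Cr).
Definition pi_x_y_z_tu : cell r4 b5 :=
  cpad pre_x_y_z_tu (Cpi x y z tu) post_x_y_z_tu.

Definition k5_side2 : cell k5_source b5 :=
  pi_x_y_z_tu • (nat_1 • (pi_x_yz_t_u • (pi_yztu • nat_2))).

(* c5_j and d5_j are the 2-isomorphisms gamma and gamma' that pad the j-th    *)
(* term of the coboundary in degree 3.                                        *)
Definition c5_0 := pre_yztu.
Definition d5_0 := pi_x_y_z_tu • (nat_1 • (pi_x_yz_t_u • post_yztu)).
Definition c5_1 :=
  pre_xy_z_t_u • (nat_3 • (pi_x_y_zt_u • (pi_xyzt • Cinv nat_2))).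
Definition d5_1 := post_xy_z_t_u.
Definition c5_2 := pre_x_yz_t_u • pi_yztu.
Definition d5_2 := pi_x_y_z_tu • (nat_1 • post_x_yz_t_u).
Definition c5_3 := pre_x_y_zt_u • (pi_xyzt • Cinv nat_2).
Definition d5_3 := pi_xy_z_t_u • (nat_3 • post_x_y_zt_u).
Definition c5_4 := pre_x_y_z_tu • (nat_1 • (pi_x_yz_t_u • pi_yztu)).
Definition d5_4 := post_x_y_z_tu.
Definition c5_5 := pre_xyzt • Cinv nat_2.
Definition d5_5 := pi_xy_z_t_u • (nat_3 • (pi_x_y_zt_u • post_xyzt)).

End K5.
End CanonicalCells.

Section Pentagonator.
Context {K : comPzRingType} {C : lin2cat K} {T : tensor C} (a : associator T).

(* Pseudomodifications from a^(n+1) to (n+1)a, for n = 2, 3, 4.               *)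
Definition pmod2 := forall X Y Z : C,
  hom2 (evo a (an (Lf X) [:: Lf Y; Lf Z])) (evo a (na (Lf X) [:: Lf Y; Lf Z])).
Definition pmod3 := forall X Y Z W : C,
  hom2 (evo a (an (Lf X) [:: Lf Y; Lf Z; Lf W]))
       (evo a (na (Lf X) [:: Lf Y; Lf Z; Lf W])).
Definition pmod4 := forall X Y Z W V : C,
  hom2 (evo a (an (Lf X) [:: Lf Y; Lf Z; Lf W; Lf V]))
       (evo a (na (Lf X) [:: Lf Y; Lf Z; Lf W; Lf V])).

Definition is_mod2 (m : pmod2) :=
  forall (X X' Y Y' Z Z' : C) (f : hom X X') (g : hom Y Y') (h : hom Z Z'),
  mod_square (m := an (Lf (Arr f)) [:: Lf (Arr g); Lf (Arr h)])
             (m' := na (Lf (Arr f)) [:: Lf (Arr g); Lf (Arr h)])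
             (m X Y Z) (m X' Y' Z').

Definition is_mod3 (n : pmod3) :=
  forall (X X' Y Y' Z Z' W W' : C)
    (f : hom X X') (g : hom Y Y') (h : hom Z Z') (k : hom W W'),
  mod_square
    (m := an (Lf (Arr f)) [:: Lf (Arr g); Lf (Arr h); Lf (Arr k)])
    (m' := na (Lf (Arr f)) [:: Lf (Arr g); Lf (Arr h); Lf (Arr k)])
    (n X Y Z W) (n X' Y' Z' W').

Record pentagonator := Pentagonator {
  pi : pi_data a;
  pi_mod : is_mod3 (fun X Y Z W => pi X Y Z W);
  pi_K5 : forall X Y Z W V : C,
    fw (evc pi (k5_side1 (Lf X) (Lf Y) (Lf Z) (Lf W) (Lf V)))
    = fw (evc pi (k5_side2 (Lf X) (Lf Y) (Lf Z) (Lf W) (Lf V)))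
}.

End Pentagonator.

Record semigroupal (K : comPzRingType) := Semigroupal {
  sg_cat : lin2cat K;
  sg_tensor : tensor sg_cat;
  sg_assoc : associator sg_tensor;
  sg_pi : pentagonator sg_assoc
}.

(* The set of classes of R, which is meant to be an equivalence relation.     *)
Definition quot (S : Type) (R : S -> S -> Prop) : Type :=
  {B : S -> Prop | exists x, B = R x}.

Section Cohomology.
Context {K : comPzRingType} {C : lin2cat K} {T : tensor C} {a : associator T}.
Context (P : pentagonator a).
Notation "X ⊠ Y" := (to T X Y) (at level 35).
Notation one X := (id2 (id1 X)).

Definition delta2 (m : pmod2 a) : pmod3 a := fun X Y Z W =>
  let x := Lf X in let y := Lf Y in let z := Lf Z in let w := Lf W in
    pad (pi P) (c4_0 x y z w) (d4_0 x y z w) (t2 T (one X) (m Y Z W))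
  - pad (pi P) (c4_1 x y z w) (d4_1 x y z w) (m (X ⊠ Y) Z W)
  + pad (pi P) (c4_2 x y z w) (d4_2 x y z w) (m X (Y ⊠ Z) W)
  - pad (pi P) (c4_3 x y z w) (d4_3 x y z w) (m X Y (Z ⊠ W))
  + pad (pi P) (c4_4 x y z w) (d4_4 x y z w) (t2 T (m X Y Z) (one W)).

Definition delta3 (n : pmod3 a) : pmod4 a := fun X Y Z W V =>
  let x := Lf X in let y := Lf Y in let z := Lf Z in
  let w := Lf W in let v := Lf V in
    pad (pi P) (c5_0 x y z w v) (d5_0 x y z w v) (t2 T (one X) (n Y Z W V))
  - pad (pi P) (c5_1 x y z w v) (d5_1 x y z w v) (n (X ⊠ Y) Z W V)
  + pad (pi P) (c5_2 x y z w v) (d5_2 x y z w v) (n X (Y ⊠ Z) W V)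
  - pad (pi P) (c5_3 x y z w v) (d5_3 x y z w v) (n X Y (Z ⊠ W) V)
  + pad (pi P) (c5_4 x y z w v) (d5_4 x y z w v) (n X Y Z (W ⊠ V))
  - pad (pi P) (c5_5 x y z w v) (d5_5 x y z w v) (t2 T (n X Y Z W) (one V)).

Definition cocycle3 : Type :=
  {n : pmod3 a |
    is_mod3 n /\ forall X Y Z W V : C, delta3 n X Y Z W V = 0}.

Definition cohomologous (n n' : cocycle3) : Prop :=
  exists m : pmod2 a, is_mod2 m /\
    forall X Y Z W : C,
      sval n X Y Z W - sval n' X Y Z W = delta2 m X Y Z W.

(* Cocycles modulo coboundaries *)
Definition H3pent : Type := quot cohomologous.

End Cohomology.

(******************************************************************************)
(* The 2-category C_eps: a 2-morphism t_0 + t_1 eps is the pair (t_0, t_1).    *)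
(******************************************************************************)
Section Dual.
Context {K : comPzRingType}.

Section Bilinear.
Context {U V W : lmodType K} (b : U -> V -> W).
Context (bl : forall k t t' s, b (k *: t + t') s = k *: b t s + b t' s).
Context (br : forall k t s s', b t (k *: s + s') = k *: b t s + b t s').

Definition eps2 (t : U * U) (s : V * V) : W * W :=
  (b t.1 s.1, b t.1 s.2 + b t.2 s.1).

Lemma bilD1 t t' s : b (t + t') s = b t s + b t' s.
Proof. by have := bl 1 t t' s; rewrite !scale1r. Qed.
Lemma bilD2 t s s' : b t (s + s') = b t s + b t s'.
Proof. by have := br 1 t s s'; rewrite !scale1r. Qed.
Lemma bil01 s : b 0 s = 0.
Proof. by apply: (@addrI _ (b 0 s)); rewrite -bilD1 !addr0. Qed.
Lemma bil02 t : b t 0 = 0.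
Proof. by apply: (@addrI _ (b t 0)); rewrite -bilD2 !addr0. Qed.

Lemma eps2_linl k (t t' : (U * U)%type) (s : (V * V)%type) :
  eps2 (k *: t + t') s = k *: eps2 t s + eps2 t' s.
Proof.
congr pair; rewrite /= ?bl //; rewrite scalerDr !addrA; congr (_ + _).
by rewrite addrAC.
Qed.

Lemma eps2_linr k (t : (U * U)%type) (s s' : (V * V)%type) :
  eps2 t (k *: s + s') = k *: eps2 t s + eps2 t s'.
Proof.
congr pair; rewrite /= ?br //; rewrite scalerDr !addrA; congr (_ + _).
by rewrite addrAC.
Qed.
End Bilinear.
End Dual.

Section EpsCat.
Context {K : comPzRingType} (C : lin2cat K).

Section Additivity.
Context {X Y Z : C}.
Implicit Types (f g h : hom X Y).

Lemma vcompDl f g h (t t' : hom2 g h) (s : hom2 f g) :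
  (t + t') • s = t • s + t' • s.
Proof. exact: (bilD1 (fun k t t' s => vcomp_linl k t t' s)). Qed.
Lemma vcompDr f g h (t : hom2 g h) (s s' : hom2 f g) :
  t • (s + s') = t • s + t • s'.
Proof. exact: (bilD2 (fun k t s s' => vcomp_linr k t s s')). Qed.
Lemma vcomp0l f g h (s : hom2 f g) : (0 : hom2 g h) • s = 0.
Proof. exact: (bil01 (fun k t t' s => vcomp_linl k t t' s)). Qed.
Lemma vcomp0r f g h (t : hom2 g h) : t • (0 : hom2 f g) = 0.
Proof. exact: (bil02 (fun k t s s' => vcomp_linr k t s s')). Qed.
Lemma hcompDl (g g' : hom Y Z) (f f' : hom X Y) (t t' : hom2 g g')
  (s : hom2 f f') : (t + t') ⋆ s = t ⋆ s + t' ⋆ s.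
Proof. exact: (bilD1 (fun k t t' s => hcomp_linl k t t' s)). Qed.
Lemma hcompDr (g g' : hom Y Z) (f f' : hom X Y) (t : hom2 g g')
  (s s' : hom2 f f') : t ⋆ (s + s') = t ⋆ s + t ⋆ s'.
Proof. exact: (bilD2 (fun k t s s' => hcomp_linr k t s s')). Qed.
Lemma hcomp0l (g g' : hom Y Z) (f f' : hom X Y) (s : hom2 f f') :
  (0 : hom2 g g') ⋆ s = 0.
Proof. exact: (bil01 (fun k t t' s => hcomp_linl k t t' s)). Qed.
Lemma hcomp0r (g g' : hom Y Z) (f f' : hom X Y) (t : hom2 g g') :
  t ⋆ (0 : hom2 f f') = 0.
Proof. exact: (bil02 (fun k t s s' => hcomp_linr k t s s')). Qed.
End Additivity.

Definition bilE := (@vcomp0l, @vcomp0r, @hcomp0l, @hcomp0r,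
  @addr0, @add0r, @vcompDl, @vcompDr, @hcompDl, @hcompDr).

Definition eps_hom2 (X Y : C) (f g : hom X Y) : lmodType K :=
  (hom2 f g * hom2 f g)%type.

Definition eps_id2 (X Y : C) (f : hom X Y) : eps_hom2 f f := (id2 f, 0).

Definition eps_vcomp (X Y : C) (f g h : hom X Y)
    (t : eps_hom2 g h) (s : eps_hom2 f g) : eps_hom2 f h :=
  eps2 (@vcomp K C X Y f g h) t s.

Definition eps_hcomp (X Y Z : C) (g g' : hom Y Z) (f f' : hom X Y)
    (t : eps_hom2 g g') (s : eps_hom2 f f') : eps_hom2 (g ∘ f) (g' ∘ f') :=
  eps2 (@hcomp K C X Y Z g g' f f') t s.

Lemma eps_castE (X Y : C) (f g : hom X Y) (e : f = g) :
  cast_of eps_id2 e = (cast e, 0) :> eps_hom2 f g.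
Proof. by case: _ / e. Qed.

Definition eps_cat : lin2cat K.
Proof.
refine (@Lin2cat K (ob C) (@hom K C) eps_hom2 (@id1 K C) (@comp1 K C)
  eps_id2 eps_vcomp eps_hcomp (@comp1A K C) (@comp1l K C) (@comp1r K C)
  _ _ _ _ _ _ _ _ _ _ _ _).
- abstract (move=> X Y f g h k r s t; congr pair;
    by rewrite /= ?bilE ?vcompA ?addrA).
- abstract (by move=> X Y f g [t t']; rewrite /eps_vcomp /eps2 /= !bilE !vcompl).
- abstract (by move=> X Y f g [t t']; rewrite /eps_vcomp /eps2 /= !bilE !vcompr).
- abstract (by move=> X Y Z g f; rewrite /eps_hcomp /eps2 /= !bilE hcomp_id2).
- abstract (move=> X Y Z g g' g'' f f' f'' t' t s' s; congr pair;
    [by rewrite /= interchange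
    |by rewrite /= !bilE !interchange !addrA;
        congr (_ + _); rewrite addrAC]).
- abstract (by move=> X Y Z W h h' g g' f f' r s t;
    rewrite !eps_castE /eps_vcomp /eps_hcomp /eps2 /= !bilE !hcompA !addrA).
- abstract (by move=> X Y f f' t;
    rewrite !eps_castE /eps_vcomp /eps_hcomp /eps2 /= !bilE !hcompl).
- abstract (by move=> X Y f f' t;
    rewrite !eps_castE /eps_vcomp /eps_hcomp /eps2 /= !bilE !hcompr).
- abstract (move=> X Y f g h k t t' s;
    apply: eps2_linl => *; exact: vcomp_linl).
- abstract (move=> X Y f g h k t s s';
    apply: eps2_linr => *; exact: vcomp_linr).
- abstract (move=> X Y Z g g' f f' k t t' s;
    apply: eps2_linl => *; exact: hcomp_linl).
- abstract (move=> X Y Z g g' f f' k t s s';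
    apply: eps2_linr => *; exact: hcomp_linr).
Defined.

Lemma eps_vcomp00 (X Y : C) (f g h : hom X Y) (t : hom2 g h) (s : hom2 f g) :
  eps_vcomp (t, 0) (s, 0) = (t • s, 0).
Proof. by rewrite /eps_vcomp /eps2 /= !bilE. Qed.

Lemma eps_hcomp00 (X Y Z : C) (g g' : hom Y Z) (f f' : hom X Y)
    (t : hom2 g g') (s : hom2 f f') :
  eps_hcomp (t, 0) (s, 0) = (t ⋆ s, 0).
Proof. by rewrite /eps_hcomp /eps2 /= !bilE. Qed.

Lemma eps_isoK (X Y : C) (f g : hom X Y) (t : hom2 f g) (s : hom2 g f) :
  s • t = id2 f -> eps_vcomp (s, 0) (t, 0) = eps_id2 f.
Proof. by move=> e; rewrite /eps_vcomp /eps2 /= !bilE e. Qed.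

Definition eps_iso (X Y : C) (f g : hom X Y) (t : iso2 f g) :
    @iso2 K eps_cat X Y f g :=
  @Iso2 K eps_cat X Y f g (fw t, 0) (bw t, 0)
    (eps_isoK (fwK t)) (eps_isoK (bwK t)).

End EpsCat.

Section EpsTensor.
Context {K : comPzRingType} {C : lin2cat K} (T : tensor C).

Section Additivity.
Context {X X' Y Y' : C} {f f' : hom X X'} {g g' : hom Y Y'}.
Lemma t2Dl (t t' : hom2 f f') (s : hom2 g g') :
  t2 T (t + t') s = t2 T t s + t2 T t' s.
Proof. exact: (bilD1 (fun k t t' s => t2_linl T k t t' s)). Qed.
Lemma t2Dr (t : hom2 f f') (s s' : hom2 g g') :
  t2 T t (s + s') = t2 T t s + t2 T t s'.
Proof. exact: (bilD2 (fun k t s s' => t2_linr T k t s s')). Qed.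
Lemma t20l (s : hom2 g g') : t2 T (0 : hom2 f f') s = 0.
Proof. exact: (bil01 (fun k t t' s => t2_linl T k t t' s)). Qed.
Lemma t20r (t : hom2 f f') : t2 T t (0 : hom2 g g') = 0.
Proof. exact: (bil02 (fun k t s s' => t2_linr T k t s s')). Qed.
End Additivity.

Definition eps_t2 (X X' Y Y' : C) (f f' : hom X X') (g g' : hom Y Y')
    (t : eps_hom2 f f') (s : eps_hom2 g g') :
    eps_hom2 (t1 T f g) (t1 T f' g') :=
  eps2 (@t2 K C T X X' Y Y' f f' g g') t s.

Lemma eps_t200 (X X' Y Y' : C) (f f' : hom X X') (g g' : hom Y Y')
    (t : hom2 f f') (s : hom2 g g') : eps_t2 (t, 0) (s, 0) = (t2 T t s, 0).
Proof. by rewrite /eps_t2 /eps2 /= t20l t20r addr0. Qed.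

Definition eps_pure := (@eps_castE, @eps_vcomp00, @eps_hcomp00, @eps_t200).

Definition eps_tensor : tensor (eps_cat C).
Proof.
refine (@Tensor K (eps_cat C) (to T) (@t1 K C T) eps_t2
  (fun X X' X'' Y Y' Y'' f' g' f g => eps_iso (th T f' g' f g))
  (fun X Y => eps_iso (t0 T X Y)) _ _ _ _ _ _ _ _).
- abstract (by move=> *; rewrite /eps_t2 /eps2 /= t20l t20r t2_id2 addr0).
- abstract (move=> X X' Y Y' f f' f'' g g' g'' t' t s' s; congr pair;
    [by rewrite /= t2_vcomp
    |by rewrite /= !bilE !t2Dl !t2Dr !t2_vcomp !addrA;
        congr (_ + _); rewrite addrAC]).
- abstract (move=> X X' Y Y' f f' g g' k t t' s;
    apply: eps2_linl => *; exact: t2_linl).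
- abstract (move=> X X' Y Y' f f' g g' k t s s';
    apply: eps2_linr => *; exact: t2_linr).
- abstract (move=> X X' X'' Y Y' Y'' f' h' g' k' f h g k t' s' t s; congr pair;
    [by rewrite /= th_nat
    |by rewrite /= !(bilE, t2Dl, t2Dr) !th_nat addrACA]).
- abstract (by move=> *; rewrite /= !eps_pure th_assoc).
- abstract (by move=> *; rewrite /= !eps_pure th_unitl).
- abstract (by move=> *; rewrite /= !eps_pure th_unitr).
Defined.

Definition eps_assoc (a : associator T) : associator eps_tensor.
Proof.
refine (@Associator K (eps_cat C) eps_tensor (as1 a)
  (fun X X' Y Y' Z Z' f g h => eps_iso (ah a f g h)) (as1_inv a) _ _ _).
- abstract (move=> X X' Y Y' Z Z' f f' g g' h h' r s t; congr pair;
    [by rewrite /= ah_nat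
    |by rewrite /= !(bilE, t2Dl, t2Dr) !ah_nat !addrA]).
- abstract (by move=> *; rewrite /thL /thR /= !eps_pure ah_comp).
- abstract (by move=> *; rewrite /t0L /t0R /= !eps_pure ah_unit).
Defined.

End EpsTensor.

Section Omega.
Context {K : comPzRingType} {C : lin2cat K} {T : tensor C} (a : associator T).
Notation one X := (id2 (id1 X)).

(* The components of omega when psi is the identity                           *)
Definition omega_data := forall X Y Z : C,
  hom2 (as1 a X Y Z ∘ t1 T (id1 X) (id1 (to T Y Z)))
       (t1 T (id1 (to T X Y)) (id1 Z) ∘ as1 a X Y Z).

Definition omega_triv : omega_data := fun X Y Z =>
  (bw (t0 T (to T X Y) Z) ⋆ id2 (as1 a X Y Z))
  • cast (esym (comp1l (as1 a X Y Z)))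
  • cast (comp1r (as1 a X Y Z))
  • (id2 (as1 a X Y Z) ⋆ t0 T X (to T Y Z)).

Definition omega_bar (w : omega_data) : pmod2 a := fun X Y Z =>
  cast (comp1l (as1 a X Y Z))
  • (t0 T (to T X Y) Z ⋆ id2 (as1 a X Y Z))
  • w X Y Z
  • (id2 (as1 a X Y Z) ⋆ bw (t0 T X (to T Y Z)))
  • cast (esym (comp1r (as1 a X Y Z))).

(* (id, w) is a semigroupal structure on the identity 2-functor from the      *)
(* pentagonator p to the pentagonator p'.                                     *)
Definition is_omega (p p' : pmod3 a) (w : omega_data) : Prop :=
  let v := omega_bar w in
  [/\ is_mod2 v, forall X Y Z : C, invertible2 (v X Y Z)
    & forall X Y Z W : C,
      (v (to T X Y) Z W ⋆ v X Y (to T Z W)) • p X Y Z W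
      = p' X Y Z W
        • (t2 T (v X Y Z) (one W)
             ⋆ (v X (to T Y Z) W ⋆ t2 T (one X) (v Y Z W)))].

End Omega.

Section Deformations.
Context {K : comPzRingType} {C : lin2cat K} {T : tensor C} {a : associator T}.
Context (P : pentagonator a).

Definition deformation : Type :=
  {p : pmod3 (eps_assoc a) |
    (forall X Y Z W : C, (p X Y Z W).1 = pi P X Y Z W) /\
    exists Q : pentagonator (eps_assoc a),
      forall X Y Z W : C, pi Q X Y Z W = p X Y Z W :> hom2 _ _}.

Definition omega_equiv (p p' : deformation) : Prop :=
  exists w : omega_data (eps_assoc a),
    (forall X Y Z : C, (w X Y Z).1 = omega_triv a X Y Z) /\
    is_omega (sval p) (sval p') w.

Definition omega_classes : Type := quot omega_equiv.

End Deformations.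

(* Main.v *)
(* Write a first order deformation of pi as pi + n eps.  Every 2-morphism built
   from otimes and a only is unchanged in C_eps, so the eps-part of a pasting is
   a sum with one padded occurrence of n for each pentagonator in it.  Hence the
   modification squares and K5 hold for pi + n eps if and only if n is a
   modification and delta n = 0: the pentagonators on the two sides of K5 are
   the even and the odd terms of delta n.  Likewise omega-bar = 1 + m eps for a
   modification m, and the eps-part of the compatibility of omega with
   pi + n eps and pi + n' eps is n - n' = delta m. *)

From mathcomp Require Import all_boot all_algebra boolp.
Require Import Defs.

Set Implicit Arguments.
Unset Strict Implicit.
Unset Printing Implicit Defensive.
Import GRing.Theory.
Local Open Scope ring_scope.
Local Open Scope twocat_scope.

(** * Bijections between sets of classes *)

Section Quotients.
Context {S S' : Type} (R : S -> S -> Prop) (R' : S' -> S' -> Prop).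

(** Classes are predicates, so they are transported by precomposition: pulling [R x] back along
    [psi] gives [R' (phi x)], and pulling back along [phi] inverts this because [phi] reflects the
    relation. *)
Lemma quot_bijective (phi : S -> S') (psi : S' -> S) :
    (forall y, phi (psi y) = y) ->
    (forall x x', R x x' <-> R' (phi x) (phi x')) ->
  exists F : quot R -> quot R', bijective F.
Proof.
move=> psiK phiR.
have img B : (exists x, B = R x) ->
    exists y, (fun y => B (psi y)) = R' y.
  case=> x ->; exists (phi x); apply: funext => y.
  by apply: propext; rewrite phiR psiK.
have pre D : (exists y, D = R' y) -> exists x, (fun x => D (phi x)) = R x.
  case=> y ->; exists (psi y); apply: funext => x.
  by apply: propext; rewrite phiR psiK.
exists (fun B => exist _ _ (img _ (svalP B))).
exists (fun D => exist _ _ (pre _ (svalP D))).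
- move=> [B [x eB]]; apply: eq_exist; apply: funext => y /=.
  by apply: propext; rewrite eB !phiR psiK.
- by move=> [D ?]; apply: eq_exist; apply: funext => y /=; rewrite psiK.
Qed.

End Quotients.

(** * First order variation of pastings and of the two sides of K5 *)

Section K5Variation.
Context {K : comPzRingType} {C : lin2cat K} {X Y : C}.

Lemma vcompNl (f g h : hom X Y) (t : hom2 g h) (s : hom2 f g) :
  (- t) • s = - (t • s).
Proof. by apply/eqP; rewrite -addr_eq0 -vcompDl addNr vcomp0l. Qed.

Lemma vcompNr (f g h : hom X Y) (t : hom2 g h) (s : hom2 f g) :
  t • (- s) = - (t • s).
Proof. by apply/eqP; rewrite -addr_eq0 -vcompDr addNr vcomp0r. Qed.

(* [A • N1 • B • D • N2] and [A' • N3 • B' • D'] stand for the two sides of K5,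
   and the [k_i] for the first order parts of their pentagonators; cancelling
   [N2] is needed because K5 starts at [k5_source] and [delta3] at [a^(5)]. *)
Lemma K5_variation (s a5 r2 r3 r4 l1 l2 l3 b5 : hom X Y)
    (A k4 : hom2 r4 b5) (N1 : hom2 r3 r4) (B k2 : hom2 r2 r3)
    (D k0 : hom2 a5 r2) (N2 : hom2 s a5) (N2' : hom2 a5 s)
    (A' k1 : hom2 l3 b5) (N3 : hom2 l2 l3) (B' k3 : hom2 l1 l2)
    (D' k5 : hom2 s l1) :
  N2 • N2' = id2 a5 ->
  A • (N1 • (B • k0)) - k1 • (N3 • (B' • (D' • N2')))
  + A • (N1 • (k2 • D)) - A' • (N3 • (k3 • (D' • N2')))
  + k4 • (N1 • (B • D)) - A' • (N3 • (B' • (k5 • N2')))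
  = (A • (N1 • (B • (D • 0 + k0 • N2) + k2 • (D • N2)) + 0 • (B • (D • N2)))
     + k4 • (N1 • (B • (D • N2)))
     - (A' • (N3 • (B' • k5 + k3 • D') + 0 • (B' • D'))
        + k1 • (N3 • (B' • D')))) • N2'.
Proof.
move=> N2K; rewrite !bilE vcompNl !bilE -!vcompA !N2K !vcompr !opprD !addrA.
by rewrite [LHS](ACl (1*3*5*6*4*2)).
Qed.

End K5Variation.

Section EpsCells.
Context {K : comPzRingType} {C : lin2cat K} {T : tensor C} {a : associator T}.
Context (P : pi_data a) (Q : pi_data (eps_assoc a)).
Hypothesis Q1 : forall X Y Z W : C, (fw (Q X Y Z W)).1 = P X Y Z W.

Lemma bw_uniq (X Y : C) (f g : hom X Y) (t : iso2 f g) (s : hom2 g f) :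
  s • t = id2 f -> s = bw t.
Proof. by move=> st; rewrite -[LHS]vcompr -(bwK t) vcompA st vcompl. Qed.

Lemma bw_eps1 (X Y Z W : C) : (bw (Q X Y Z W)).1 = bw (P X Y Z W).
Proof.
apply: bw_uniq; rewrite -Q1.
exact: (congr1 fst (fwK (Q X Y Z W))).
Qed.

(** Setting eps to 0 respects all operations. Inverses are carried along in the induction because
    [Cinv] exchanges the two directions. *)
Lemma evc_eps1 (s t : tree C) (m m' : apath s t) (c : cell m m') :
  (fw (evc Q c)).1 = fw (evc P c) /\ (bw (evc Q c)).1 = bw (evc P c).
Proof.
elim: c => //=.
- by move=> s' t' n n' c [].
- by move=> s' t' n n' n'' c [e1 e2] d [e3 e4]; rewrite e1 e2 e3 e4.
- by move=> s' t' u n n' l l' c [e1 e2] d [e3 e4]; rewrite e1 e2 e3 e4.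
- by move=> s' t' u v n n' l l' c [e1 e2] d [e3 e4]; rewrite e1 e2 e3 e4.
- by move=> *; split; rewrite eps_castE.
- by move=> *; split; rewrite eps_castE.
- by move=> *; split; rewrite eps_castE.
- by move=> *; split; [exact: Q1|exact: bw_eps1].
Qed.

(** Singles out the cells that surround the pentagonators in K5; only [Cpi] can introduce an
    eps-part. *)
Fixpoint pi_free (A : Type) (s t : tree A) (m m' : apath s t)
    (c : cell m m') : bool :=
  match c with
  | Cpi _ _ _ _ => false
  | Cinv _ _ _ _ c => pi_free c
  | Cv _ _ _ _ _ c d => pi_free c && pi_free d
  | Ch _ _ _ _ _ _ _ c d => pi_free c && pi_free d
  | Ct _ _ _ _ _ _ _ _ c d => pi_free c && pi_free d
  | _ => true
  end.

Lemma evc_pi_free (s t : tree C) (m m' : apath s t) (c : cell m m') :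
  pi_free c -> (fw (evc Q c)).2 = 0 /\ (bw (evc Q c)).2 = 0.
Proof.
elim: c => //=.
- by move=> s' t' n n' c IH /IH [].
- by move=> s' t' n n' n'' c IHc d IHd /andP[/IHc [-> ->] /IHd [-> ->]];
    rewrite !bilE.
- by move=> s' t' u n n' l l' c IHc d IHd /andP[/IHc [-> ->] /IHd [-> ->]];
    rewrite !bilE.
- by move=> s' t' u v n n' l l' c IHc d IHd /andP[/IHc [-> ->] /IHd [-> ->]];
    rewrite !t20l !t20r !addr0.
- by move=> *; rewrite !eps_castE.
- by move=> *; rewrite !eps_castE.
- by move=> *; rewrite !eps_castE.
Qed.

(** Leibniz rule for the eps-part. *)
Lemma evc_Cv (s t : tree C) (m m' m'' : apath s t) (c : cell m' m'')
    (d : cell m m') :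
  (fw (evc Q (Cv c d))).2
  = fw (evc P c) • (fw (evc Q d)).2 + (fw (evc Q c)).2 • fw (evc P d).
Proof. by rewrite /= (evc_eps1 c).1 (evc_eps1 d).1. Qed.

Lemma evc_cpad (s s' t' t : tree C) (p q : apath s t)
    (g : apath s s') (f f' : apath s' t') (g' : apath t' t)
    (c : cell p (g' ∘ (f ∘ g))%AP) (k : cell f f')
    (c' : cell (g' ∘ (f' ∘ g))%AP q) :
  pi_free c -> pi_free c' ->
  (fw (evc Q (cpad c k c'))).2 = pad P c c' (fw (evc Q k)).2.
Proof.
move=> cF c'F; rewrite /cpad !evc_Cv.
by rewrite (evc_pi_free cF).1 (evc_pi_free c'F).1 /pad /= !bilE.
Qed.

(** With [pad_post], splits the long paddings [c5_j], [d5_j] into the short padding of one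
    pentagonator and the other steps of its side of K5. *)
Lemma pad_pre (s s' t' t : tree C) (p p' q : apath s t)
    (g : apath s s') (f f' : apath s' t') (g' : apath t' t)
    (c : cell p (g' ∘ (f ∘ g))%AP) (c' : cell (g' ∘ (f' ∘ g))%AP q)
    (d : cell p' p) (k : hom2 (evo a f) (evo a f')) :
  pad P (Cv c d) c' k = pad P c c' k • fw (evc P d).
Proof. by rewrite /pad /= !vcompA. Qed.

Lemma pad_post (s s' t' t : tree C) (p q q' : apath s t)
    (g : apath s s') (f f' : apath s' t') (g' : apath t' t)
    (c : cell p (g' ∘ (f ∘ g))%AP) (c' : cell (g' ∘ (f' ∘ g))%AP q)
    (d : cell q q') (k : hom2 (evo a f) (evo a f')) :
  pad P c (Cv d c') k = fw (evc P d) • pad P c c' k.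
Proof. by rewrite /pad /= !vcompA. Qed.

Lemma evc_whiskerl (x : C) (s t : tree C) (m m' : apath s t) (c : cell m m') :
  (fw (evc Q (Ct (@Cid _ _ _ (Pid (Lf x))) c))).2
  = t2 T (id2 (id1 x)) (fw (evc Q c)).2.
Proof. by rewrite /= t20l addr0. Qed.

Lemma evc_whiskerr (x : C) (s t : tree C) (m m' : apath s t) (c : cell m m') :
  (fw (evc Q (Ct c (@Cid _ _ _ (Pid (Lf x)))))).2
  = t2 T (fw (evc Q c)).2 (id2 (id1 x)).
Proof. by rewrite /= t20r add0r. Qed.

End EpsCells.

Section Coboundary3.
Context {K : comPzRingType} {C : lin2cat K} {T : tensor C} {a : associator T}.
Context (P : pentagonator a) (Q : pi_data (eps_assoc a)).
Hypothesis Q1 : forall X Y Z W : C, (fw (Q X Y Z W)).1 = pi P X Y Z W.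

Let n : pmod3 a := fun X Y Z W => (fw (Q X Y Z W)).2.

(** The Leibniz rule along a side of K5 leaves one padded [n] per pentagonator. Side 2 gives the
    terms of even index, side 1 those of odd index; the inverse of [nat_2] moves the source from
    [k5_source] to a^(5). *)
Lemma delta3_eps (X Y Z W V : C) :
  let x := Lf X in let y := Lf Y in let z := Lf Z in
  let w := Lf W in let v := Lf V in
  delta3 P n X Y Z W V
  = ((fw (evc Q (k5_side2 x y z w v))).2 - (fw (evc Q (k5_side1 x y z w v))).2)
    • bw (evc (pi P) (nat_2 x y z w v)).
Proof.
move=> x y z w v; rewrite /k5_side1 /k5_side2.
rewrite (evc_Cv Q1 (pi_x_y_z_tu x y z w v)) (evc_Cv Q1 (nat_1 x y z w v)).
rewrite (evc_Cv Q1 (pi_x_yz_t_u x y z w v)).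
rewrite (evc_Cv Q1 (pi_yztu x y z w v) (nat_2 x y z w v)).
rewrite (evc_Cv Q1 (pi_xy_z_t_u x y z w v)) (evc_Cv Q1 (nat_3 x y z w v)).
rewrite (evc_Cv Q1 (pi_x_y_zt_u x y z w v)).
rewrite (evc_pi_free Q (isT : pi_free (nat_1 x y z w v))).1.
rewrite (evc_pi_free Q (isT : pi_free (nat_2 x y z w v))).1.
rewrite (evc_pi_free Q (isT : pi_free (nat_3 x y z w v))).1.
rewrite !(evc_cpad Q1) //.
rewrite evc_whiskerl evc_whiskerr.
set A := fw (evc _ (pi_x_y_z_tu _ _ _ _ _)).
set N1 := fw (evc _ (nat_1 _ _ _ _ _)).
set B := fw (evc _ (pi_x_yz_t_u _ _ _ _ _)).
(* The even terms: the remaining steps of side 2 after [nat_2] are peeled off the padding. *)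
have e0 k : pad (pi P) (c5_0 x y z w v) (d5_0 x y z w v) k
    = A • (N1 • (B • pad (pi P) (pre_yztu x y z w v) (post_yztu x y z w v) k)).
  by rewrite -!pad_post.
have e2 k : pad (pi P) (c5_2 x y z w v) (d5_2 x y z w v) k
    = A • (N1 • (pad (pi P) (pre_x_yz_t_u x y z w v) (post_x_yz_t_u x y z w v) k
      • fw (evc (pi P) (pi_yztu x y z w v)))).
  by rewrite -pad_pre -!pad_post.
have e4 k : pad (pi P) (c5_4 x y z w v) (d5_4 x y z w v) k
    = pad (pi P) (pre_x_y_z_tu x y z w v) (post_x_y_z_tu x y z w v) k
      • (N1 • (B • fw (evc (pi P) (pi_yztu x y z w v)))).
  exact: pad_pre.
set A' := fw (evc _ (pi_xy_z_t_u _ _ _ _ _)).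
set N3 := fw (evc _ (nat_3 _ _ _ _ _)).
set B' := fw (evc _ (pi_x_y_zt_u _ _ _ _ _)).
set D' := fw (evc _ (pi_xyzt _ _ _ _ _)).
set N2' := bw _.
(* The odd terms: here the padding also starts with the inverse [N2'] of [nat_2]. *)
have e1 k : pad (pi P) (c5_1 x y z w v) (d5_1 x y z w v) k
    = pad (pi P) (pre_xy_z_t_u x y z w v) (post_xy_z_t_u x y z w v) k
      • (N3 • (B' • (D' • N2'))).
  exact: pad_pre.
have e3 k : pad (pi P) (c5_3 x y z w v) (d5_3 x y z w v) k
    = A' • (N3 • (pad (pi P) (pre_x_y_zt_u x y z w v) (post_x_y_zt_u x y z w v) k
      • (D' • N2'))).
  transitivity (A' • (N3 • pad (pi P) (c5_3 x y z w v)
    (post_x_y_zt_u x y z w v) k)); first by rewrite -!pad_post.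
  by congr (_ • (_ • _)); exact: pad_pre.
have e5 k : pad (pi P) (c5_5 x y z w v) (d5_5 x y z w v) k
    = A' • (N3 • (B' • (pad (pi P) (pre_xyzt x y z w v) (post_xyzt x y z w v) k
      • N2'))).
  transitivity (A' • (N3 • (B' • pad (pi P) (c5_5 x y z w v)
    (post_xyzt x y z w v) k))); first by rewrite -!pad_post.
  by congr (_ • (_ • (_ • _))); exact: pad_pre.
rewrite /delta3 -/x -/y -/z -/w -/v.
rewrite e0 e1 e2 e3 e4 e5.
exact: K5_variation (bwK _).
Qed.

End Coboundary3.

(** * Modification squares over the dual numbers *)

Section EpsModifications.
Context {K : comPzRingType} {C : lin2cat K} {T : tensor C} {a : associator T}.

(** As [u] and [u'] have no eps-part, the two coefficients of the square do not mix. *)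
Lemma eps_square (X Y Z W : C) (f : hom X Y) (g : hom Z W)
    (p p' : hom X Z) (q q' : hom Y W)
    (u : hom2 (g ∘ p) (q ∘ f)) (u' : hom2 (g ∘ p') (q' ∘ f))
    (m : eps_hom2 p p') (m' : eps_hom2 q q') :
  eps_vcomp (u', 0) (eps_hcomp (eps_id2 g) m)
  = eps_vcomp (eps_hcomp m' (eps_id2 f)) (u, 0)
  <-> u' • (id2 g ⋆ m.1) = (m'.1 ⋆ id2 f) • u
      /\ u' • (id2 g ⋆ m.2) = (m'.2 ⋆ id2 f) • u.
Proof.
rewrite /eps_vcomp /eps_hcomp /eps2 /= !bilE.
by split=> [[]|[-> ->]].
Qed.

Lemma is_mod2_eps (m : pmod2 (eps_assoc a)) :
  is_mod2 m <-> is_mod2 (a := a) (fun X Y Z => (m X Y Z).1)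
    /\ is_mod2 (a := a) (fun X Y Z => (m X Y Z).2).
Proof.
split=> [mM|[m1M m2M] X X' Y Y' Z Z' f g h].
  by split=> X X' Y Y' Z Z' f g h; have /eps_square[] := mM _ _ _ _ _ _ f g h.
by apply/eps_square; split; [exact: m1M|exact: m2M].
Qed.

(* Labels in [eps_cat C] and in [C] have different types [arr], so [hat] is
   compared on the two paths a^(4), (4)a rather than by induction on paths. *)
Section Hat.
Variables (X X' Y Y' Z Z' W W' : C).
Variables (f : hom X X') (g : hom Y Y') (h : hom Z Z') (k : hom W W').

Lemma hat_an_eps :
  hat (eps_assoc a) (an (Lf (@Arr K (eps_cat C) _ _ f))
    [:: Lf (@Arr K (eps_cat C) _ _ g); Lf (@Arr K (eps_cat C) _ _ h);
        Lf (@Arr K (eps_cat C) _ _ k)])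
  = (hat a (an (Lf (Arr f)) [:: Lf (Arr g); Lf (Arr h); Lf (Arr k)]), 0).
Proof.
rewrite /= !eps_castE /eps_id2.
by do 4!rewrite ?eps_vcomp00 ?eps_hcomp00 ?eps_t200.
Qed.

Lemma hat_na_eps :
  hat (eps_assoc a) (na (Lf (@Arr K (eps_cat C) _ _ f))
    [:: Lf (@Arr K (eps_cat C) _ _ g); Lf (@Arr K (eps_cat C) _ _ h);
        Lf (@Arr K (eps_cat C) _ _ k)])
  = (hat a (na (Lf (Arr f)) [:: Lf (Arr g); Lf (Arr h); Lf (Arr k)]), 0).
Proof.
rewrite /= !eps_castE /eps_id2.
by do 4!rewrite ?eps_vcomp00 ?eps_hcomp00 ?eps_t200.
Qed.

End Hat.

Lemma is_mod3_eps (n : pmod3 (eps_assoc a)) :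
  is_mod3 n <-> is_mod3 (a := a) (fun X Y Z W => (n X Y Z W).1)
    /\ is_mod3 (a := a) (fun X Y Z W => (n X Y Z W).2).
Proof.
split=> [nM|[n1M n2M] X X' Y Y' Z Z' W W' f g h k].
  by split=> X X' Y Y' Z Z' W W' f g h k;
    have := nM _ _ _ _ _ _ _ _ f g h k;
    rewrite /mod_square hat_an_eps hat_na_eps => /eps_square[].
rewrite /mod_square hat_an_eps hat_na_eps.
by apply/eps_square; split; [exact: n1M|exact: n2M].
Qed.

End EpsModifications.

(** * Deformations of the pentagonator and 3-cocycles *)

Section Correspondence.
Context {K : comPzRingType} {C : lin2cat K} {T : tensor C} {a : associator T}.
Context (P : pentagonator a).

(** The truncated geometric series inverts t + n eps for every n, so deforming an invertible
    2-morphism never destroys invertibility. *)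
Lemma eps_iso2_fwK (X Y : C) (f g : hom X Y) (t : iso2 f g) (n : hom2 f g) :
  eps_vcomp (bw t, - (bw t • n • bw t)) (fw t, n) = eps_id2 f.
Proof.
rewrite /eps_vcomp /eps2 /= fwK vcompNl -!vcompA fwK vcompr.
by rewrite subrr.
Qed.

Lemma eps_iso2_bwK (X Y : C) (f g : hom X Y) (t : iso2 f g) (n : hom2 f g) :
  eps_vcomp (fw t, n) (bw t, - (bw t • n • bw t)) = eps_id2 g.
Proof.
rewrite /eps_vcomp /eps2 /= bwK vcompNr !vcompA bwK vcompl.
by rewrite addNr.
Qed.

Definition eps_pi (n : pmod3 a) : pi_data (eps_assoc a) := fun X Y Z W =>
  @Iso2 K (eps_cat C) _ _ _ _ _ _
    (eps_iso2_fwK (pi P X Y Z W) (n X Y Z W))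
    (eps_iso2_bwK (pi P X Y Z W) (n X Y Z W)).

(** In order zero both sides agree by K5 for [P]; in order one [delta3_eps] applies, and [nat_2]
    cancels since it is invertible. *)
Lemma delta3_eps_eq0 (Q : pi_data (eps_assoc a)) (X Y Z W V : C) :
    (forall X Y Z W : C, (fw (Q X Y Z W)).1 = pi P X Y Z W) ->
  fw (evc Q (k5_side1 (Lf X) (Lf Y) (Lf Z) (Lf W) (Lf V)))
    = fw (evc Q (k5_side2 (Lf X) (Lf Y) (Lf Z) (Lf W) (Lf V)))
  <-> delta3 P (fun X Y Z W => (fw (Q X Y Z W)).2) X Y Z W V = 0.
Proof.
move=> Q1; rewrite (delta3_eps Q1); set N := evc _ (nat_2 _ _ _ _ _).
have e := pi_K5 P X Y Z W V.
rewrite -(evc_eps1 Q1 _).1 -(evc_eps1 Q1 (k5_side2 _ _ _ _ _)).1 in e.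
split=> [-> | /(congr1 (fun t => t • fw N))]; first by rewrite subrr vcomp0l.
rewrite vcomp0l -vcompA fwK vcompr => /subr0_eq e2.
(* Boolean equality on a product is a conjunction, settled by [e] and [e2]. *)
by apply/esym/eqP; apply/andP; split; apply/eqP.
Qed.

Lemma deformation_cocycle (p : deformation P) :
  let n := fun X Y Z W : C => (sval p X Y Z W).2 in
  is_mod3 (a := a) n /\ forall X Y Z W V : C, delta3 P n X Y Z W V = 0.
Proof.
case: p => p [p1 [Q Qp]] n /=.
have Q1 X Y Z W : (fw (pi Q X Y Z W)).1 = pi P X Y Z W by rewrite Qp p1.
have -> : n = fun X Y Z W => (fw (pi Q X Y Z W)).2.
  by do 4!apply: functional_extensionality_dep => ?; rewrite Qp.
split=> [|X Y Z W V]; first exact: ((is_mod3_eps _).1 (pi_mod Q)).2.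
by apply/delta3_eps_eq0 => //; exact: pi_K5.
Qed.

Lemma cocycle_deformation (n : cocycle3 P) :
  let p : pmod3 (eps_assoc a) :=
    fun X Y Z W => (fw (pi P X Y Z W), sval n X Y Z W) in
  (forall X Y Z W : C, (p X Y Z W).1 = pi P X Y Z W) /\
  exists Q : pentagonator (eps_assoc a),
    forall X Y Z W : C, pi Q X Y Z W = p X Y Z W :> hom2 _ _.
Proof.
case: n => n [nM n0] p /=; split=> //.
have QM : is_mod3 (fun X Y Z W => fw (eps_pi n X Y Z W)).
  by apply/is_mod3_eps; split; [exact: (pi_mod P)|exact: nM].
have QK X Y Z W V := (@delta3_eps_eq0 (eps_pi n) X Y Z W V
  (fun _ _ _ _ => erefl)).2 (n0 X Y Z W V).
by exists (Pentagonator QM QK).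
Qed.

End Correspondence.

(** * The degree 2 coboundary and omega-equivalence *)

Section Coboundary2.
Context {K : comPzRingType} {C : lin2cat K} {T : tensor C} {a : associator T}.
Context (P : pentagonator a).

Lemma hcompl_conj (X Y : C) (f f' : hom X Y) (t : hom2 f f') :
  cast (comp1l f') • (id2 (id1 Y) ⋆ t) • cast (esym (comp1l f)) = t.
Proof. by rewrite hcompl -vcompA cast_bwK vcompr. Qed.

Lemma hcompr_conj (X Y : C) (f f' : hom X Y) (t : hom2 f f') :
  cast (comp1r f') • (t ⋆ id2 (id1 X)) • cast (esym (comp1r f)) = t.
Proof. by rewrite hcompr -vcompA cast_bwK vcompr. Qed.

(** Removes the padding of the term of index 0, whose path ends on the right in an identity. *)
Lemma whiskerr_conj (X Y Z V : C) (h : hom Z V) (g : hom Y Z)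
    (f f' : hom X Y) (t : hom2 f f') :
  cast (esym (comp1A h g f')) • (id2 (h ∘ g) ⋆ cast (comp1r f'))
    • (id2 (h ∘ g) ⋆ (t ⋆ id2 (id1 X)))
    • (id2 (h ∘ g) ⋆ cast (esym (comp1r f))) • cast (comp1A h g f)
  = id2 h ⋆ (id2 g ⋆ t).
Proof.
rewrite -!vcompA (vcompA (_ ⋆ (_ ⋆ _))) (vcompA (_ ⋆ cast _)) -!interchange.
rewrite !vcompl (vcompA (cast (comp1r _))) hcompr_conj -hcomp_id2.
by rewrite -hcompA vcompA cast_fwK vcompl.
Qed.

(** The padding consists of unit and associativity casts and of [pi]. The even terms vary the source
    of [pi], the odd ones its target, as in the compatibility condition on omega. *)
Lemma delta2E (m : pmod2 a) (X Y Z W : C) :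
  delta2 P m X Y Z W
  = pi P X Y Z W
    • (t2 T (m X Y Z) (id2 (id1 W)) ⋆ id2 _
       + id2 _ ⋆ (m X (to T Y Z) W ⋆ id2 _)
       + id2 _ ⋆ (id2 _ ⋆ t2 T (id2 (id1 X)) (m Y Z W)))
    - (m (to T X Y) Z W ⋆ id2 _ + id2 _ ⋆ m X Y (to T Z W)) • pi P X Y Z W.
Proof.
rewrite /delta2 /pad /=.
(* The permutation sorts the right side by the index of the coboundary terms. *)
rewrite vcompDl !vcompDr opprD !addrA [RHS](ACl (3*4*2*5*1)).
congr (_ - _ + _ - _ + _).
- by rewrite -!vcompA; congr (_ • _); rewrite !vcompA whiskerr_conj.
- by rewrite !vcompA hcompl_conj.
- by rewrite vcompr.
- by rewrite !vcompA -!interchange !vcompl hcompr_conj.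
- by rewrite -!vcompA; congr (_ • _); rewrite !vcompA hcompl_conj.
Qed.

End Coboundary2.

Section OmegaBar.
Context {K : comPzRingType} {C : lin2cat K} {T : tensor C} (a : associator T).

(** Undoes the conjugation in [omega_bar]; the identity of [a] yields [omega_triv]. *)
Definition omega_unbar (m : pmod2 a) : omega_data a := fun X Y Z =>
  (bw (t0 T (to T X Y) Z) ⋆ id2 (as1 a X Y Z))
  • cast (esym (comp1l (as1 a X Y Z)))
  • m X Y Z
  • cast (comp1r (as1 a X Y Z))
  • (id2 (as1 a X Y Z) ⋆ t0 T X (to T Y Z)).

Lemma omega_unbarK (m : pmod2 a) (X Y Z : C) :
  omega_bar (omega_unbar m) X Y Z = m X Y Z.
Proof.
rewrite /omega_bar /omega_unbar -!vcompA.
rewrite !(vcompA (_ ⋆ _) (_ ⋆ _)) -!interchange !bwK !vcompl !hcomp_id2 !vcompl.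
by rewrite cast_bwK vcompr vcompA cast_bwK vcompl.
Qed.

Lemma omega_bar_triv (X Y Z : C) :
  omega_bar (omega_triv a) X Y Z = id2 (as1 a X Y Z).
Proof.
rewrite -(omega_unbarK (fun X Y Z => id2 (as1 a X Y Z))).
by rewrite /omega_bar /omega_unbar vcompr.
Qed.

Lemma omega_bar_eps (w : omega_data (eps_assoc a)) (X Y Z : C) :
  omega_bar w X Y Z
  = (omega_bar (a := a) (fun X Y Z => (w X Y Z).1) X Y Z,
     omega_bar (a := a) (fun X Y Z => (w X Y Z).2) X Y Z).
Proof.
rewrite /omega_bar /= !eps_castE.
rewrite /eps_vcomp /eps_hcomp /eps2 /=.
by rewrite !bilE.
Qed.

End OmegaBar.

Section OmegaEquivalence.
Context {K : comPzRingType} {C : lin2cat K} {T : tensor C} {a : associator T}.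
Context (P : pentagonator a).

(** 1 + m eps, the shape of omega-bar when omega is trivial modulo eps; its inverse is 1 - m eps. *)
Definition eps_unipotent (m : pmod2 a) : pmod2 (eps_assoc a) :=
  fun X Y Z => (id2 (as1 a X Y Z), m X Y Z).

Lemma eps_unipotent_mod (m : pmod2 a) : is_mod2 (eps_unipotent m) <-> is_mod2 m.
Proof.
rewrite is_mod2_eps; split=> [[]|mM] //; split=> //.
by move=> X X' Y Y' Z Z' f g h; rewrite /mod_square /= !hcomp_id2 vcompl vcompr.
Qed.

Lemma eps_unipotent_inv (m : pmod2 a) (X Y Z : C) :
  @invertible2 K (eps_cat C) _ _ _ _ (eps_unipotent m X Y Z).
Proof.
exists (id2 (as1 a X Y Z), - m X Y Z).
by rewrite /= /eps_vcomp /eps2 /= !vcompl !vcompr subrr addNr.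
Qed.

Lemma sub_eq_sub (V : zmodType) (x y s b : V) :
  x - y = s - b <-> x + b = s + y.
Proof.
split=> /eqP e; apply/eqP.
  by rewrite eq_sym -subr_eq addrAC eq_sym -subr_eq.
by rewrite subr_eq addrAC eq_sym subr_eq eq_sym.
Qed.

(** Both sides reduce to [pi] modulo eps. Their eps-parts are [p.2] plus the variation of the target
    and [p'.2] plus that of the source, and [delta2E] is the difference of these variations. *)
Lemma eps_unipotent_pi (m : pmod2 a) (X Y Z W : C)
    (p p' : eps_hom2 (pi_source a X Y Z W) (pi_target a X Y Z W)) :
    p.1 = pi P X Y Z W -> p'.1 = pi P X Y Z W ->
  let v := eps_unipotent m in
  eps_vcomp (eps_hcomp (v (to T X Y) Z W) (v X Y (to T Z W))) p
  = eps_vcomp p' (eps_hcomp (eps_t2 T (v X Y Z) (eps_id2 (id1 W)))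
      (eps_hcomp (v X (to T Y Z) W) (eps_t2 T (eps_id2 (id1 X)) (v Y Z W))))
  <-> p.2 - p'.2 = delta2 P m X Y Z W.
Proof.
case: p p' => [p n] [p' n'] /= -> ->.
rewrite delta2E /eps_unipotent /eps_vcomp /eps_hcomp /eps_t2 /eps2 /=.
rewrite !t20l !t20r !bilE !t2_id2 !hcomp_id2 !vcompl !vcompr.
apply: iff_trans (iff_sym (sub_eq_sub _ _ _ _)).
rewrite (addrC (_ ⋆ m X Y _ • _)) [X in (_, X + n')](ACl (3*2*1)) /=.
by split=> [[]|->].
Qed.

Lemma omega_equivP (p p' : deformation P) :
  omega_equiv p p' <-> exists m : pmod2 a, is_mod2 m /\
    forall X Y Z W : C,
      (sval p X Y Z W).2 - (sval p' X Y Z W).2 = delta2 P m X Y Z W.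
Proof.
case: p p' => [p [p1 Qp]] [p' [p'1 Qp']]; rewrite /omega_equiv /=.
split=> [[w [w1 wP]]|[m [mM mP]]].
  pose m : pmod2 a := omega_bar (a := a) (fun X Y Z => (w X Y Z).2).
  (* The order zero part is the identity because [w] reduces to [omega_triv]. *)
  have wE : omega_bar w = eps_unipotent m.
    do 3!apply: functional_extensionality_dep => ?.
    rewrite omega_bar_eps /eps_unipotent -omega_bar_triv; congr pair.
    by rewrite /omega_bar w1.
  exists m; case: wP; rewrite wE => /eps_unipotent_mod mM _ mP.
  split=> // X Y Z W.
  have [+ _] := eps_unipotent_pi m (p1 X Y Z W) (p'1 X Y Z W).
  by apply; exact: mP.
(* Chosen so that its bar is 1 + m eps. *)
pose w : omega_data (eps_assoc a) :=
  fun X Y Z => (omega_triv a X Y Z, omega_unbar m X Y Z).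
have wE : omega_bar w = eps_unipotent m.
  do 3!apply: functional_extensionality_dep => ?.
  rewrite omega_bar_eps /eps_unipotent -omega_bar_triv; congr pair.
  exact: omega_unbarK.
exists w; split=> //; split; rewrite wE.
- exact/eps_unipotent_mod.
- exact: eps_unipotent_inv.
- move=> X Y Z W.
  have [_ +] := eps_unipotent_pi m (p1 X Y Z W) (p'1 X Y Z W).
  by apply; exact: mP.
Qed.

End OmegaEquivalence.

Theorem theorem7p9 (K : comPzRingType) (S : semigroupal K) :
  exists F : omega_classes (sg_pi S) -> H3pent (sg_pi S),
    bijective F.
Proof.
pose phi (p : deformation (sg_pi S)) : cocycle3 (sg_pi S) :=
  exist _ _ (deformation_cocycle p).
pose psi (n : cocycle3 (sg_pi S)) : deformation (sg_pi S) :=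
  exist _ _ (cocycle_deformation n).
(* [phi] takes the eps-part and [psi] forms pi + n eps; the proof components are equal by proof
   irrelevance. *)
apply: (@quot_bijective _ _ _ _ phi psi) => [n|p p'].
  by case: n => n ?; apply: eq_exist.
exact: omega_equivP.
Qed.
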